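(* Let $A$ be a finite set with $N\ge2$ elements, and let $K$ be a finite set of possible contents of an individual vote, the content $k\in K$ being represented by a Llull matrix $v^k$ on $A$ (the zero matrix representing an empty vote). For relative frequencies $\alpha=(\alpha_k)_{k\in K}$, $\alpha_k\ge0$, $\sum_k\alpha_k=1$, let $v=\sum_{k}\alpha_kv^k$ be the collective Llull matrix and $f=\sum_{k:\,v^k\ne0}\alpha_k$ the fraction of non-empty votes. Then the rank-like rates $r_x$ and the fraction-like rates $\varphi_x$ ($x\in A$) are continuous functions of $\alpha$.
   Context: Let $A$ be a finite set with $N$ elements and $\Pi$ the set of ordered pairs $xy$ with $x,y\in A$, $x\ne y$. A relation on $A$ is a subset of $\Pi$. A Llull matrix on $A$ is a family $v=(v_{xy})_{xy\in\Pi}$ with $v_{xy}\in[0,1]$ and $v_{xy}+v_{yx}\le1$. Turnovers: $t_{xy}=v_{xy}+v_{yx}$. Indirect scores: $v^*_{xy}=\max\min_{0\le i<n}v_{x_ix_{i+1}}$, the max being over all paths $x_0x_1\dots x_n$ ($n\ge1$, consecutive elements distinct) with $x_0=x$, $x_n=y$. Put $m^\nu_{xy}=v^*_{xy}-v^*_{yx}$, $\nu=\{xy\in\Pi: m^\nu_{xy}>0\}$, $\hat\nu=\{xy\in\Pi: m^\nu_{xy}\ge0\}$. An admissible order is a (strict) total order $\xi\subseteq\Pi$ with $\nu\subseteq\xi\subseteq\hat\nu$; one always exists. Write $x\succ y$ for $xy\in\xi$, $x\succeq y$ for $x\succ y$ or $x=y$, and $x'$ for the immediate successor of $x$ in $\xi$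 (for $x$ not last). Given an admissible order $\xi$, the projected scores are obtained as follows. (i) For $x\succ y$: $m^\sigma_{xy}=\min\{m^\nu_{pq}: p\succeq x,\ y\succeq q\}$. (ii) $(t^\sigma_{xy})_{xy\in\Pi}$ is the unique minimizer of $\sum_{xy\in\Pi}(\tau_{xy}-t_{xy})^2$ among all real families $(\tau_{xy})_{xy\in\Pi}$ such that $\tau_{xy}=\tau_{yx}$ for all $xy$; $m^\sigma_{xx'}\le\tau_{xx'}\le1$ for all non-last $x$; $0\le\tau_{xy}-\tau_{xy'}\le m^\sigma_{yy'}$ for all non-last $y$ and all $x\notin\{y,y'\}$. (iii) $\gamma_{xx'}=[(t^\sigma_{xx'}-m^\sigma_{xx'})/2,\ (t^\sigma_{xx'}+m^\sigma_{xx'})/2]$, and for $x\succ y$, $\gamma_{xy}=\bigcup\{\gamma_{pp'}: x\succeq p\succ y\}$, which is a closed interval. (iv) For $x\succ y$: $v^\pi_{xy}=\max\gamma_{xy}$, $v^\pi_{yx}=\min\gamma_{xy}$. The projected scores do not depend on the choice of $\xi$. Put $t^\pi_{xy}=v^\pi_{xy}+v^\pi_{yx}$. Rank-like rates: $r_x=N-\sum_{y\ne x}v^\pi_{xy}$. Fraction-like rates: if $v=0$ (full abstention, $f=0$), $\varphi_x=0$ for all $x$. If $v\neq0$ (so $f>0$ and $(v^\pi_{xy})\ne0$): there is a unique nonempty set $X\subseteq A$ (the top dominant irreducible component of $(v^\pi_{xy})$) such that any two distinct elements of $X$ can be joined in both directions by paths along which $v^\pi>0$, every $y\notin X$ can be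 reached from every $x\in X$ by such a path, and no $x\in X$ can be reached by such a path from any $y\notin X$. Then $\varphi_x=0$ for $x\notin X$, and $(\varphi_x)_{x\in X}$ is the unique family of positive numbers with $\sum_{x\in X}\varphi_x=f$ and $\sum_{y\in X,\,y\ne x}t^\pi_{xy}\,\varphi_x/(\varphi_x+\varphi_y)=\sum_{y\in X,\,y\neq x}v^\pi_{xy}$ for all $x\in X$. *)

(* Defs.v *)
From HB Require Import structures.
From mathcomp Require Import all_boot all_order all_algebra.
From mathcomp Require Import all_classical all_reals all_analysis.

Set Implicit Arguments.
Unset Strict Implicit.
Unset Printing Implicit Defensive.

Import Order.TTheory GRing.Theory Num.Theory.
Import numFieldNormedType.Exports.

Local Open Scope classical_set_scope.
Local Open Scope ring_scope.

(* A family indexed by the ordered pairs xy with x != y is encoded as a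
   function A -> A -> R whose diagonal values are never used.  A relation on A
   is a set of pairs. *)

Section Votes.
Context {R : realType} {A : finType}.
Implicit Types (v w t tau : A -> A -> R) (xi : {set A * A}) (x y : A).

Definition llull v : Prop :=
  forall x y, x != y -> 0 <= v x y <= 1 /\ v x y + v y x <= 1.

Definition zero_offdiag v : bool :=
  [forall x, forall y, (x != y) ==> (v x y == 0)].

Definition turnover v x y : R := v x y + v y x.

(* The minimum of v along the steps of the path x, y, s_0, s_1, ... *)
Fixpoint path_score v x y (s : seq A) : R :=
  if s is z :: s' then Num.min (v x y) (path_score v y z s') else v x y.

(* Only finitely many values occur among the scores of the paths from x to y,
   so that the supremum is a maximum. *)
Definition indirect_score v x y : R :=
  sup [set r | exists z s, [/\ path (fun a b => a != b) x (z :: s),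
                               last x (z :: s) = y
                             & r = path_score v x z s]].

Definition indirect_margin v x y : R :=
  indirect_score v x y - indirect_score v y x.

Definition nu v : {set A * A} :=
  [set p | (p.1 != p.2) && (0 < indirect_margin v p.1 p.2)]%SET.

Definition nu_hat v : {set A * A} :=
  [set p | (p.1 != p.2) && (0 <= indirect_margin v p.1 p.2)]%SET.

Definition strict_total_order xi : bool :=
  [&& [forall x, (x, x) \notin xi],
      [forall x, forall y, forall z,
         ((x, y) \in xi) && ((y, z) \in xi) ==> ((x, z) \in xi)]
    & [forall x, forall y, (x != y) ==> ((x, y) \in xi) || ((y, x) \in xi)]].

Definition admissible_order v xi : bool :=
  [&& strict_total_order xi, nu v \subset xi & xi \subset nu_hat v].

Definition weakly_before xi x y : bool := (x == y) || ((x, y) \in xi).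

(* [next_in xi x x']: x' is the immediate successor of x. *)
Definition next_in xi x y : bool :=
  ((x, y) \in xi) && [forall z, ~~ (((x, z) \in xi) && ((z, y) \in xi))].

(* Meant for (x, y) \in xi; the seed of the minimum is then its term
   (p, q) = (x, y). *)
Definition projected_margin v xi x y : R :=
  \big[Num.min/indirect_margin v x y]_(p : A * A |
     weakly_before xi p.1 x && weakly_before xi y p.2)
     indirect_margin v p.1 p.2.

Definition feasible_turnovers v xi : set (A -> A -> R) :=
  [set tau | [/\ forall x y, x != y -> tau x y = tau y x,
    forall x x', next_in xi x x' ->
      projected_margin v xi x x' <= tau x x' <= 1
  & forall y y' x, next_in xi y y' -> x != y -> x != y' ->
      0 <= tau x y - tau x y' <= projected_margin v xi y y']].

Definition turnover_distance v tau : R :=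
  \sum_(p : A * A | p.1 != p.2) (tau p.1 p.2 - turnover v p.1 p.2) ^+ 2.

(* The minimizer is unique off the diagonal. *)
Definition projected_turnover v xi : A -> A -> R :=
  get [set tau | feasible_turnovers v xi tau /\
         forall tau', feasible_turnovers v xi tau' ->
           turnover_distance v tau <= turnover_distance v tau'].

Definition gamma_next v xi x x' : set R :=
  let t := projected_turnover v xi x x' in
  let m := projected_margin v xi x x' in
  [set` `[(t - m) / 2, (t + m) / 2]].

Definition gamma v xi x y : set R :=
  [set r | exists p p', [/\ next_in xi p p', weakly_before xi x p,
                            (p, y) \in xi & gamma_next v xi p p' r]].

(* For (x, y) \in xi the set gamma v xi x y is a nonempty closed bounded
   interval, so that sup and inf are its maximum and its minimum. *)
Definition projected_scores_along v xi x y : R :=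
  if (x, y) \in xi then sup (gamma v xi x y) else inf (gamma v xi y x).

(* There is always an admissible order, and the projected scores do not depend
   on which one is picked. *)
Definition projected_scores v : A -> A -> R :=
  projected_scores_along v (odflt finset.set0 [pick xi | admissible_order v xi]).

Definition rank_rate v x : R :=
  #|A|%:R - \sum_(y | y != x) projected_scores v x y.

Definition positive_path w : rel A :=
  connect (fun a b => (a != b) && (0 < w a b)).

Definition top_dominant_component w (X : {set A}) : bool :=
  [&& X != finset.set0,
      [forall x in X, forall y in X, (x != y) ==> positive_path w x y],
      [forall x in X, forall y, (y \notin X) ==> positive_path w x y]
    & [forall x in X, forall y, (y \notin X) ==> ~~ positive_path w y x]].

Definition is_fraction_rates w f (X : {set A}) (phi : A -> R) : Prop :=
  [/\ forall x, x \notin X -> phi x = 0,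
      forall x, x \in X -> 0 < phi x,
      \sum_(x in X) phi x = f
    & forall x, x \in X ->
        \sum_(y in X | y != x) turnover w x y * (phi x / (phi x + phi y))
        = \sum_(y in X | y != x) w x y].

Definition fraction_rate v (f : R) : A -> R :=
  if zero_offdiag v then fun=> 0
  else let w := projected_scores v in
       let X := odflt finset.set0 [pick X | top_dominant_component w X] in
       get [set phi | is_fraction_rates w f X phi].

End Votes.

Section Collective.
Context {R : realType} {A K : finType}.
Implicit Types (vk : K -> A -> A -> R) (alpha : {ptws K -> R}).

Definition relative_frequencies : set {ptws K -> R} :=
  [set alpha | (forall k, 0 <= alpha k) /\ \sum_k alpha k = 1].

Definition collective_matrix vk alpha (x y : A) : R :=
  \sum_k alpha k * vk k x y.

Definition nonempty_fraction vk alpha : R :=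
  \sum_(k | ~~ zero_offdiag (vk k)) alpha k.

End Collective.

(* Main.v *)
Require Import Defs.
From HB Require Import structures.
From mathcomp Require Import all_boot all_order all_algebra.
From mathcomp Require Import fingroup perm ring lra zify.
From mathcomp Require Import all_classical all_reals all_analysis.

Set Implicit Arguments.
Unset Strict Implicit.
Unset Printing Implicit Defensive.

Import Order.TTheory GRing.Theory Num.Theory.
Import numFieldNormedType.Exports.

Local Open Scope classical_set_scope.
Local Open Scope ring_scope.

(* Ultrafilters replace subsequences: a bounded real function converges along
   an ultrafilter and a function with finitely many values is eventually
   constant. So when the scores converge to v0, one may assume that a single
   order xi is admissible for all of them, hence for v0, and that the projected
   turnovers converge. A turnover family feasible for v0 becomes feasible for
   nearby scores when mixed with a small proportion of the constant family 1, so
   the limit is the minimizer for v0. As the projected scores do not depend on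
   the admissible order (two admissible orders are joined by transpositions of
   neighbours with zero margin), they are continuous.

   For the fraction-like rates one may likewise assume that the top component is
   constant along the ultrafilter. Summing the rate equations over suitable sets
   shows that the support of the limit is the top component of v0, where the
   uniqueness of the positive solution identifies the limit. The positive
   solution exists as a maximizer of Zermelo's likelihood. *)

(** * Limits along ultrafilters *)

(** The constraints on the turnovers move with the scores. Closedness makes a limit of feasible
    families feasible, but its optimality requires every competitor for [v0] to be approached by
    families feasible for the nearby scores. The constant family 1 has slack in both constraints
    that involve a margin m0 of [v0], except when m0 = 0 in the upper bound on differences or m0 = 1
    in the lower bound on turnovers of neighbours; there the bounds 0 <= m <= 1 on the nearby
    margins suffice. For the fraction-like rates the obstacle is that positive scores may vanish in
    the limit: the top component can shrink, and a quotient phi x / (phi x + phi y) can degenerate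
    to 0 / 0. The rate equations are therefore passed to the limit only at those x whose limit rate
    is positive. *)

Lemma cvg_ultra (T : Type) (U : topologicalType) (F : set_system T)
    {FF : Filter F} (g : T -> U) (l : U) :
  (forall G : set_system T, UltraFilter G -> F `<=` G -> g @ G --> l) ->
  g @ F --> l.
Proof.
move=> ultra_cvg V Vl; apply: contrapT => nFV.
(* A neighbourhood V whose preimage is outside [F] leaves a proper trace of [F] on the complement;
   an ultrafilter refining that trace contradicts the hypothesis. *)
have PF : ProperFilter (within (~` (g @^-1` V)) F).
  apply: Build_ProperFilter_ex => B FB; apply: contrapT => nB.
  apply: nFV; have {}FB : F [set a | ~ V (g a) -> B a] by exact: FB.
  suff : F (g @^-1` V) by [].
  apply: filterS FB => a Ba; apply: contrapT => nVa.
  by apply: nB; exists a; apply: Ba.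
have [G [GU FG]] := ultraFilterLemma PF.
have sFG : F `<=` G.
  move=> B FB; apply: FG; suff : F [set a | ~ V (g a) -> B a] by [].
  by apply: filterS FB => a Ba _.
have GV : G (g @^-1` V) := ultra_cvg G GU sFG V Vl.
have GnV : G (~` (g @^-1` V)) by apply: FG; exact: withinT.
by have [a []] := filter_ex (filterI GV GnV).
Qed.

Lemma ultra_bounded_cvg (R : realType) (T : Type) (G : set_system T)
    {GU : UltraFilter G} (g : T -> R) (a b : R) :
  (\forall t \near G, a <= g t <= b) -> exists l : R, g @ G --> l.
Proof.
move=> gab.
have PG : ProperFilter (g @ G) by exact: fmap_proper_filter.
(* Compactness gives a limit for an ultrafilter [H] refining the image of [G]. The limit transfers
   back because [G] decides the preimage of every neighbourhood. *)
have [H [HU GH]] := ultraFilterLemma PG.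
have := @segment_compact R a b; rewrite compact_ultra => /(_ H HU).
case; first by apply: GH; apply: filterS gab => t; rewrite /= in_itv.
move=> l [_ Hl]; exists l => V Vl.
have [//|GnV] := in_ultra_setVsetC (g @^-1` V) GU.
have HnV : H (~` V) by apply: GH.
by have [c []] := filter_ex (filterI (Hl _ Vl) HnV).
Qed.

Lemma ultra_fin (T : Type) (I : finType) (G : set_system T)
    {GU : UltraFilter G} (g : T -> I) : exists i, \forall t \near G, g t = i.
Proof.
apply: contrapT => none.
have : \forall t \near G, forall i, g t <> i.
  apply: filter_forall => i.
  have [Gi|//] := in_ultra_setVsetC [set t | g t = i] GU.
  by case: none; exists i.
by move=> /filter_ex[t /(_ (g t))].
Qed.

(* The sublevel sets of h at heights decreasing to its infimum generate a
   proper filter; the minimum is a limit along any finer ultrafilter. *)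
Lemma exists_minimizer (R : realType) (T : Type) (S : set T) (h : T -> R) (m : R) :
  S !=set0 -> (forall t, S t -> m <= h t) ->
  (forall G : set_system T, UltraFilter G -> G S ->
     exists2 t, S t & h @ G --> h t) ->
  exists2 t, S t & forall t', S t' -> h t <= h t'.
Proof.
move=> [t0 St0] hm comp.
have hasE : has_inf (h @` S).
  by split; [exists (h t0), t0 | exists m => _ [t St <-]; exact: hm].
pose B (e : R) := [set t | S t /\ h t < inf (h @` S) + e].
have FB : ProperFilter (filter_from [set e : R | 0 < e] B).
  apply: filter_from_proper.
    apply: filter_from_filter; first by exists 1 => /=.
    move=> e1 e2 /= e1_gt0 e2_gt0; exists (Num.min e1 e2).
      by rewrite /= lt_min e1_gt0.
    move=> t [St ht]; split; split=> //; apply: (lt_le_trans ht);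
      by rewrite lerD2l ge_min lexx ?orbT.
  move=> e /= e0; have [_ [t St <-] ht] := inf_adherent e0 hasE.
  by exists t.
have [G [GU BG]] := ultraFilterLemma FB.
have GB e : 0 < e -> G (B e) by move=> e0; apply: BG; exists e.
have GS : G S by apply: filterS (GB 1 ltr01) => t [].
have [t St ht] := comp G GU GS.
exists t => // t' St'.
suff -> : h t = inf (h @` S) by apply: ge_inf; [case: hasE | exists t'].
have hinf : h @ G --> inf (h @` S).
  apply/cvgrPdist_lt => e e0; near=> s.
  have [Ss hs] : B e s by near: s; apply: GB.
  have his : inf (h @` S) <= h s by apply: ge_inf; [case: hasE | exists s].
  by rewrite distrC ger0_norm ?subr_ge0 // ltrBlDl.
exact: (cvg_unique _ ht hinf).
Unshelve. all: by end_near. Qed.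

Lemma cvg_minr (R : realType) (T : Type) (F : set_system T) {FF : Filter F}
    (f g : T -> R) (a b : R) :
  f @ F --> a -> g @ F --> b -> Num.min (f t) (g t) @[t --> F] --> Num.min a b.
Proof.
move=> fa gb; rewrite minr_absE; under eq_cvg do rewrite minr_absE.
apply: cvgM; last exact: cvg_cst.
by apply: cvgB; [apply: cvgD | apply: cvg_norm; apply: cvgB].
Qed.

Lemma cvg_maxr (R : realType) (T : Type) (F : set_system T) {FF : Filter F}
    (f g : T -> R) (a b : R) :
  f @ F --> a -> g @ F --> b -> Num.max (f t) (g t) @[t --> F] --> Num.max a b.
Proof.
move=> fa gb; rewrite maxr_absE; under eq_cvg do rewrite maxr_absE.
apply: cvgM; last exact: cvg_cst.
by apply: cvgD; [apply: cvgD | apply: cvg_norm; apply: cvgB].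
Qed.

Lemma cvg_bigmin (R : realType) (T I : Type) (F : set_system T)
    {FF : Filter F} (r : seq I) (P : pred I) (s : T -> R) (s0 : R)
    (f : I -> T -> R) (f0 : I -> R) :
  s @ F --> s0 -> (forall i, P i -> f i @ F --> f0 i) ->
  \big[Num.min/s t]_(i <- r | P i) f i t @[t --> F] -->
    \big[Num.min/s0]_(i <- r | P i) f0 i.
Proof.
move=> ss ff; elim: r => [|i r IHr].
  by rewrite big_nil; under eq_cvg do rewrite big_nil.
rewrite big_cons; under eq_cvg do rewrite big_cons.
by case: ifPn => // Pi; apply: cvg_minr => //; apply: ff.
Qed.

Lemma cvg_bigmax (R : realType) (T I : Type) (F : set_system T)
    {FF : Filter F} (r : seq I) (P : pred I) (s : T -> R) (s0 : R)
    (f : I -> T -> R) (f0 : I -> R) :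
  s @ F --> s0 -> (forall i, P i -> f i @ F --> f0 i) ->
  \big[Num.max/s t]_(i <- r | P i) f i t @[t --> F] -->
    \big[Num.max/s0]_(i <- r | P i) f0 i.
Proof.
move=> ss ff; elim: r => [|i r IHr].
  by rewrite big_nil; under eq_cvg do rewrite big_nil.
rewrite big_cons; under eq_cvg do rewrite big_cons.
by case: ifPn => // Pi; apply: cvg_maxr => //; apply: ff.
Qed.

Lemma cvg_sumr (R : realType) (T I : Type) (F : set_system T)
    {FF : Filter F} (r : seq I) (P : pred I) (f : I -> T -> R) (f0 : I -> R) :
  (forall i, P i -> f i @ F --> f0 i) ->
  \sum_(i <- r | P i) f i t @[t --> F] --> \sum_(i <- r | P i) f0 i.
Proof.
move=> ff; elim: r => [|i r IHr].
  by rewrite big_nil; under eq_cvg do rewrite big_nil; exact: cvg_cst.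
rewrite big_cons; under eq_cvg do rewrite big_cons.
by case: ifPn => // Pi; apply: cvgD => //; exact: ff.
Qed.

Lemma cvg_le (R : realType) (T : Type) (F : set_system T) {FF : ProperFilter F}
    (f g : T -> R) (a b : R) :
  f @ F --> a -> g @ F --> b -> (\forall t \near F, f t <= g t) -> a <= b.
Proof.
move=> fa gb fg; rewrite leNgt; apply/negP => ba.
have [c /andP[bc ca]] : exists c, b < c < a by exists ((b + a) / 2); apply/andP; lra.
have fc : \forall t \near F, c < f t by exact: (cvgr_gt _ fa).
have gc : \forall t \near F, g t < c by exact: (cvgr_lt _ gb).
have [t [[ft gt]]] := filter_ex (filterI (filterI fc gc) fg).
by rewrite leNgt (lt_trans gt ft).
Qed.

(** * Indirect scores *)

Section IndirectScores.
Context {R : realType} {A : finType}.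
Implicit Types (v : A -> A -> R) (x y z : A) (s : seq A).

Definition unit_scores v := forall x y, x != y -> 0 <= v x y <= 1.

Lemma llull_unit_scores v : llull v -> unit_scores v.
Proof. by move=> lv x y /lv[]. Qed.

Local Notation scores v x y :=
  [set r | exists z s, [/\ path (fun a b => a != b) x (z :: s),
                           last x (z :: s) = y & r = path_score v x z s]].

Lemma path_score_bounds v x z s : unit_scores v ->
  path (fun a b => a != b) x (z :: s) -> 0 <= path_score v x z s <= 1.
Proof.
move=> v01; elim: s x z => [|z' s IHs] x z /=; first by rewrite andbT => /v01.
case/andP=> /v01/andP[v0 v1] /IHs/andP[s0 s1].
by rewrite le_min v0 s0 ge_min v1.
Qed.

Lemma path_score_cat v x z s z' s' :
  path_score v x z (s ++ z' :: s') =
  Num.min (path_score v x z s) (path_score v (last z s) z' s').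
Proof. by elim: s x z => [|a s IHs] x z //=; rewrite IHs minA. Qed.

Lemma path_score_lip v v' e x z s :
  (forall a b, a != b -> `|v a b - v' a b| <= e) ->
  path (fun a b => a != b) x (z :: s) ->
  path_score v x z s <= path_score v' x z s + e.
Proof.
move=> vv'; elim: s x z => [|z' s IHs] x z /=.
  by rewrite andbT => /vv'; rewrite ler_norml => /andP[_]; rewrite lerBlDl addrC.
case/andP=> /vv'; rewrite ler_norml => /andP[_ xz] /IHs zs.
rewrite addr_minl le_min !ge_min.
by rewrite zs orbT -lerBlDl xz.
Qed.

Lemma scores_ubound v x y : unit_scores v -> has_ubound (scores v x y).
Proof.
move=> v01; exists 1 => _ [z [s [xzs _ ->]]].
by have /andP[] := path_score_bounds v01 xzs.
Qed.

Lemma indirect_score_bounds v x y : unit_scores v -> x != y ->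
  0 <= indirect_score v x y <= 1.
Proof.
move=> v01 xy; apply/andP; split; last first.
  apply: ge_sup; first by exists (v x y), y, [::]; rewrite /= xy.
  move=> _ [z [s [xzs _ ->]]]; by have /andP[] := path_score_bounds v01 xzs.
have /andP[v0 _] := v01 _ _ xy; apply: (le_trans v0).
apply: ub_le_sup; first exact: scores_ubound.
by exists y, [::]; rewrite /= xy.
Qed.

Lemma indirect_score_trans v x y z : unit_scores v -> x != y -> y != z ->
  Num.min (indirect_score v x y) (indirect_score v y z) <= indirect_score v x z.
Proof.
move=> v01 xy yz; rewrite leNgt lt_min; apply/negP => /andP[].
case/(sup_gt (ex_intro _ (v x y) _)).
  by exists y, [::]; rewrite /= xy.
move=> _ [a [s [xas lasts ->]]] lt1.
case/(sup_gt (ex_intro _ (v y z) _)).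
  by exists z, [::]; rewrite /= yz.
move=> _ [b [s' [ybs' lasts' ->]]] lt2.
have : path_score v x a (s ++ b :: s') <= indirect_score v x z.
  apply: ub_le_sup; first exact: scores_ubound.
  exists a, (s ++ b :: s'); split => //.
  - by rewrite -cat_cons cat_path xas lasts.
  - by rewrite -cat_cons last_cat lasts.
rewrite path_score_cat (_ : last a s = y) //.
by rewrite leNgt lt_min lt1 lt2.
Qed.

(** All path scores are Lipschitz with the same constant, hence so is their supremum. Continuity
    then follows without reducing the infinitely many paths to finitely many. *)
Lemma indirect_score_lip v v' e x y : unit_scores v -> unit_scores v' ->
  (forall a b, a != b -> `|v a b - v' a b| <= e) -> x != y ->
  indirect_score v x y <= indirect_score v' x y + e.
Proof.
move=> v01 v01' vv' xy; apply: ge_sup.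
  by exists (v x y), y, [::]; rewrite /= xy.
move=> _ [z [s [xzs lasts ->]]].
apply: (le_trans (path_score_lip vv' xzs)); rewrite lerD2r.
apply: ub_le_sup; first exact: scores_ubound.
by exists z, s.
Qed.

Lemma cvg_indirect_score (T : Type) (F : set_system T) {FF : Filter F}
    (v : T -> A -> A -> R) v0 x y :
  (\forall t \near F, unit_scores (v t)) -> unit_scores v0 ->
  (forall a b, v t a b @[t --> F] --> v0 a b) -> x != y ->
  indirect_score (v t) x y @[t --> F] --> indirect_score v0 x y.
Proof.
move=> v01 v001 cvgv xy; apply/cvgrPdist_le => e e0.
have close : \forall t \near F, forall a b, `|v0 a b - v t a b| <= e.
  apply: filter_forall => a; apply: filter_forall => b.
  by move/cvgrPdist_le : (cvgv a b); apply.
near=> t.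
have vt01 : unit_scores (v t) by near: t.
have cl : forall a b, `|v0 a b - v t a b| <= e by near: t.
rewrite ler_norml lerBlDl lerNl opprB lerBlDl addrC (addrC e).
rewrite !indirect_score_lip // => a b _; by rewrite distrC.
Unshelve. all: by end_near. Qed.

Lemma indirect_marginN v x y : indirect_margin v y x = - indirect_margin v x y.
Proof. by rewrite /indirect_margin opprB. Qed.

Lemma cvg_indirect_margin (T : Type) (F : set_system T) {FF : Filter F}
    (v : T -> A -> A -> R) v0 x y :
  (\forall t \near F, unit_scores (v t)) -> unit_scores v0 ->
  (forall a b, v t a b @[t --> F] --> v0 a b) -> x != y ->
  indirect_margin (v t) x y @[t --> F] --> indirect_margin v0 x y.
Proof.
move=> v01 v001 cvgv xy.
by apply: cvgB; apply: cvg_indirect_score => //; rewrite eq_sym.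
Qed.

Lemma indirect_margin_le1 v x y : unit_scores v -> x != y ->
  indirect_margin v x y <= 1.
Proof.
move=> v01 xy; rewrite /indirect_margin.
have /andP[_ ?] := indirect_score_bounds v01 xy.
have yx : y != x by rewrite eq_sym.
have /andP[? _] := indirect_score_bounds v01 yx.
lra.
Qed.

(** Transitivity of Schulze's beatpath relation: the max-min inequality is applied at the three
    corners of the cycle x, y, z, and each choice of the smaller terms is refuted linearly. *)
Lemma indirect_margin_trans v x y z : unit_scores v ->
  x != y -> y != z -> x != z ->
  0 < indirect_margin v x y -> 0 < indirect_margin v y z ->
  0 < indirect_margin v x z.
Proof.
move=> v01 xy yz xz; rewrite !subr_gt0 => xy_gt yz_gt.
have [yx zy zx] : [/\ y != x, z != y & z != x] by rewrite !(eq_sym y) !(eq_sym z).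
have := indirect_score_trans v01 xy yz.
have := indirect_score_trans v01 yz zx.
have := indirect_score_trans v01 zx xy.
rewrite !ge_min ltNge.
by move=> /orP[] ? /orP[] ? /orP[] ?; apply/negP => ?; lra.
Qed.

Lemma nuP v x y : reflect (x != y /\ 0 < indirect_margin v x y) ((x, y) \in nu v).
Proof. by rewrite inE /=; exact: andP. Qed.

Lemma nu_trans v x y z : unit_scores v ->
  (x, y) \in nu v -> (y, z) \in nu v -> (x, z) \in nu v.
Proof.
move=> v01 /nuP[xy mxy] /nuP[yz myz]; apply/nuP.
have xz : x != z.
  apply/eqP => xz; move: myz; rewrite -xz indirect_marginN oppr_gt0.
  by move/(lt_trans mxy); rewrite ltxx.
by split=> //; exact: indirect_margin_trans mxy myz.
Qed.

End IndirectScores.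

(** * Strict total orders and admissible orders *)

Section TotalOrders.
Context {A : finType}.
Implicit Types (xi : {set A * A}) (x y z : A).

Lemma order_irr xi x : strict_total_order xi -> (x, x) \in xi = false.
Proof. by case/and3P => /forallP/(_ x)/negbTE. Qed.

Lemma order_trans xi x y z : strict_total_order xi ->
  (x, y) \in xi -> (y, z) \in xi -> (x, z) \in xi.
Proof.
case/and3P => _ /forallP/(_ x)/forallP/(_ y)/forallP/(_ z)/implyP xyz _ xy yz.
by apply: xyz; rewrite xy.
Qed.

Lemma order_total xi x y : strict_total_order xi -> x != y ->
  (x, y) \in xi \/ (y, x) \in xi.
Proof.
case/and3P => _ _ /forallP/(_ x)/forallP/(_ y)/implyP/[apply] /orP[]; by [left|right].
Qed.

Lemma order_neq xi x y : strict_total_order xi -> (x, y) \in xi -> x != y.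
Proof. by move=> oxi xy; apply: contraTneq xy => ->; rewrite order_irr. Qed.

Lemma order_asym xi x y : strict_total_order xi -> (x, y) \in xi ->
  (y, x) \in xi = false.
Proof.
move=> oxi xy; apply/negP => yx.
by have := order_trans oxi xy yx; rewrite order_irr.
Qed.

Lemma order_notin xi x y : strict_total_order xi -> x != y ->
  ((x, y) \notin xi) = ((y, x) \in xi).
Proof.
move=> oxi xy; have [h|h] := order_total oxi xy; rewrite h ?(order_asym oxi h) //.
Qed.

Lemma before_trans xi x y z : strict_total_order xi ->
  weakly_before xi x y -> (y, z) \in xi -> (x, z) \in xi.
Proof. by move=> oxi /orP[/eqP->//|]; exact: order_trans. Qed.

Lemma trans_before xi x y z : strict_total_order xi ->
  (x, y) \in xi -> weakly_before xi y z -> (x, z) \in xi.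
Proof. by move=> oxi xy /orP[/eqP<-//|]; exact: order_trans. Qed.

Lemma weakly_beforeN xi x y : strict_total_order xi ->
  weakly_before xi x y = ((y, x) \notin xi).
Proof.
move=> oxi; rewrite /weakly_before; case: eqVneq => [->|xy] /=.
  by rewrite order_irr.
by rewrite order_notin // eq_sym.
Qed.

Lemma next_order xi x y : next_in xi x y -> (x, y) \in xi.
Proof. by case/andP. Qed.

Lemma next_succ xi x x' z : strict_total_order xi ->
  next_in xi x x' -> (x, z) \in xi -> weakly_before xi x' z.
Proof.
by move=> oxi /andP[_ /forallP/(_ z)] + xz; rewrite xz /= weakly_beforeN.
Qed.

Lemma next_pred xi x x' z : strict_total_order xi ->
  next_in xi x x' -> (z, x') \in xi -> weakly_before xi z x.
Proof.
by move=> oxi /andP[_ /forallP/(_ z)] + xz; rewrite xz andbT weakly_beforeN.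
Qed.

(** Its cardinal is the measure for the inductions along the order. *)
Definition between xi x y : {set A} :=
  [set z | ((x, z) \in xi) && ((z, y) \in xi)]%SET.

Lemma between_ltl xi x y z : strict_total_order xi ->
  (x, z) \in xi -> (z, y) \in xi -> (#|between xi x z| < #|between xi x y|)%N.
Proof.
move=> oxi xz zy; apply: proper_card; apply/properP; split.
  by apply/fintype.subsetP => t; rewrite !inE => /andP[-> /order_trans->].
by exists z; rewrite !inE ?xz ?zy // order_irr // andbF.
Qed.

Lemma between_ltr xi x y z : strict_total_order xi ->
  (x, z) \in xi -> (z, y) \in xi -> (#|between xi z y| < #|between xi x y|)%N.
Proof.
move=> oxi xz zy; apply: proper_card; apply/properP; split.
  by apply/fintype.subsetP => t; rewrite !inE => /andP[/(order_trans oxi xz)-> ->].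
by exists z; rewrite !inE ?xz ?zy // order_irr.
Qed.

Lemma nextVbetween xi x y : (x, y) \in xi -> 
  next_in xi x y \/ exists2 z, (x, z) \in xi & (z, y) \in xi.
Proof.
move=> xy; have [nxy|nxy] := boolP (next_in xi x y); [by left | right].
by move: nxy; rewrite /next_in xy /= negb_forall => /existsP[z /negPn/andP[]]; exists z.
Qed.

Lemma next_exists xi x y : strict_total_order xi -> (x, y) \in xi ->
  exists2 x', next_in xi x x' & weakly_before xi x' y.
Proof.
move=> oxi; have [n] := ubnP #|between xi x y|; elim: n y => // n IHn y lt_n xy.
have [nxy|[z xz zy]] := nextVbetween xy.
  by exists y => //; rewrite /weakly_before eqxx.
have [|x' nx' x'z] := IHn z _ xz.
  exact: leq_trans (between_ltl oxi xz zy) lt_n.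
by exists x' => //; apply/orP; right; exact: before_trans x'z zy.
Qed.

Lemma prev_exists xi x y : strict_total_order xi -> (x, y) \in xi ->
  exists2 y', next_in xi y' y & weakly_before xi x y'.
Proof.
move=> oxi; have [n] := ubnP #|between xi x y|; elim: n x => // n IHn x lt_n xy.
have [nxy|[z xz zy]] := nextVbetween xy.
  by exists x => //; rewrite /weakly_before eqxx.
have [|y' ny' zy'] := IHn z _ zy.
  exact: leq_trans (between_ltr oxi xz zy) lt_n.
by exists y' => //; apply/orP; right; exact: trans_before zy'.
Qed.

Lemma next_ind xi (P : A -> A -> Prop) : strict_total_order xi ->
  (forall x y, next_in xi x y -> P x y) ->
  (forall x y z, next_in xi x y -> (y, z) \in xi -> P y z -> P x z) ->
  forall x y, (x, y) \in xi -> P x y.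
Proof.
move=> oxi Pnext Pstep x y.
have [n] := ubnP #|between xi x y|; elim: n x => // n IHn x lt_n xy.
have [x' nx' /orP[/eqP<-|x'y]] := next_exists oxi xy; first exact: Pnext.
apply: (Pstep _ _ _ nx' x'y); apply: IHn => //.
exact: leq_trans (between_ltr oxi (next_order nx') x'y) lt_n.
Qed.

(** An element with the fewest predecessors has none; [x] supplies an inhabitant among which to
    minimize. *)
Lemma order_first xi x : strict_total_order xi ->
  exists x1, forall y, y != x1 -> (x1, y) \in xi.
Proof.
move=> oxi; pose before y := #|[set z | (z, y) \in xi]%SET|.
have [x1 _ min_x1] := @arg_minnP _ x xpredT before isT.
exists x1 => y yx1; rewrite -order_notin //; apply/negP => lt_y.
suff : (before y < before x1)%N by rewrite ltnNge min_x1.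
apply: proper_card; apply/properP; split.
  by apply/fintype.subsetP => z; rewrite !inE => /order_trans->.
by exists y; rewrite inE // order_irr.
Qed.

(* Counting predecessors turns a strict partial order into a total preorder
   that extends it; ties are broken arbitrarily. *)
Lemma linear_extension (r : {set A * A}) :
  (forall x, (x, x) \notin r) ->
  (forall x y z, (x, y) \in r -> (y, z) \in r -> (x, z) \in r) ->
  exists2 xi, strict_total_order xi & r \subset xi.
Proof.
move=> rirr rtrans.
pose c y := #|[set z | (z, y) \in r]%SET|.
pose k x : nat * nat := (c x, enum_rank x : nat).
pose lt (a b : nat * nat) := (a.1 < b.1)%N || (a.1 == b.1) && (a.2 < b.2)%N.
exists [set u | lt (k u.1) (k u.2)]%SET.
  apply/and3P; split.
  - by apply/forallP => x; rewrite inE /lt /= !ltnn andbF.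
  - apply/forallP => x; apply/forallP => y; apply/forallP => z.
    rewrite !inE /lt /=; apply/implyP.
    move: (c x) (c y) (c z) (nat_of_ord (enum_rank x)) (nat_of_ord (enum_rank y))
      (nat_of_ord (enum_rank z)); lia.
  - apply/forallP => x; apply/forallP => y; apply/implyP => xy.
    rewrite !inE /lt /=.
    have : nat_of_ord (enum_rank x) <> nat_of_ord (enum_rank y).
      by move=> /val_inj/enum_rank_inj; exact/eqP.
    move: (c x) (c y) (nat_of_ord (enum_rank x)) (nat_of_ord (enum_rank y)); lia.
apply/fintype.subsetP => -[x y] xy; rewrite inE /lt /=; apply/orP; left.
apply: proper_card; apply/properP; split.
  by apply/fintype.subsetP => z; rewrite !inE => /rtrans->.
by exists x; rewrite inE // (negbTE (rirr x)).
Qed.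

End TotalOrders.

Section Admissible.
Context {R : realType} {A : finType}.
Implicit Types (v : A -> A -> R) (xi : {set A * A}) (x y z : A).

(** A negative margin of xy would put yx in [nu v], hence in [xi], against asymmetry; this gives the
    inclusion in [nu_hat v]. *)
Lemma admissibleP v xi : reflect
  (strict_total_order xi /\ nu v \subset xi) (admissible_order v xi).
Proof.
apply: (iffP and3P) => [[]//|[oxi nuxi]]; split=> //.
apply/fintype.subsetP => -[x y] xy; rewrite inE /= (order_neq oxi xy) /= leNgt.
apply/negP => mxy; have : (y, x) \in xi.
  apply: (fintype.subsetP nuxi); apply/nuP; split.
    by rewrite eq_sym (order_neq oxi xy).
  by rewrite indirect_marginN oppr_gt0.
by rewrite (order_asym oxi xy).
Qed.

Lemma admissible_margin_ge0 v xi x y : admissible_order v xi ->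
  (x, y) \in xi -> 0 <= indirect_margin v x y.
Proof.
by case/and3P => _ _ /fintype.subsetP sub /sub; rewrite inE => /andP[].
Qed.

Lemma admissible_exists v : unit_scores v ->
  exists xi, admissible_order v xi.
Proof.
move=> v01; have [||xi oxi sub] := @linear_extension A (nu v).
- by move=> x; apply/negP => /nuP[]; rewrite eqxx.
- by move=> x y z; exact: nu_trans.
by exists xi; apply/admissibleP.
Qed.

End Admissible.

(** * Projected turnovers *)

Section ProjectedTurnover.
Context {R : realType} {A : finType}.
Implicit Types (v tau : A -> A -> R) (xi : {set A * A}) (x y z : A).

Lemma projected_margin_le v xi x y p q :
  weakly_before xi p x -> weakly_before xi y q ->
  projected_margin v xi x y <= indirect_margin v p q.
Proof. by move=> px yq; apply: (@bigmin_le_cond _ _ _ _ (p, q)); rewrite /= px. Qed.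

Lemma projected_margin_geP v xi x y c :
  reflect (forall p q, weakly_before xi p x -> weakly_before xi y q ->
             c <= indirect_margin v p q) (c <= projected_margin v xi x y).
Proof.
apply: (iffP idP) => [/le_trans le p q px yq|le]; first exact/le/projected_margin_le.
apply: le_bigmin => [|p /andP[px yq]]; last exact: le.
by apply: le; rewrite /weakly_before eqxx.
Qed.

Lemma projected_margin_bounds v xi x y : unit_scores v ->
  admissible_order v xi -> (x, y) \in xi -> 0 <= projected_margin v xi x y <= 1.
Proof.
move=> v01 adm xy; have [oxi _] := admissibleP _ _ adm; apply/andP; split.
  apply/projected_margin_geP => p q px yq; apply: admissible_margin_ge0 adm _.
  exact: trans_before (before_trans oxi px xy) yq.
apply: (@le_trans _ _ (indirect_margin v x y)).
  by apply: projected_margin_le; rewrite /weakly_before eqxx.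
by apply: indirect_margin_le1 => //; exact: order_neq xy.
Qed.

Lemma cvg_projected_margin (T : Type) (F : set_system T) {FF : Filter F}
    (v : T -> A -> A -> R) v0 xi x y :
  strict_total_order xi -> (x, y) \in xi ->
  (\forall t \near F, unit_scores (v t)) -> unit_scores v0 ->
  (forall a b, v t a b @[t --> F] --> v0 a b) ->
  projected_margin (v t) xi x y @[t --> F] --> projected_margin v0 xi x y.
Proof.
move=> oxi xy v01 v001 cvgv; apply: cvg_bigmin => [|p /andP[px yq]].
  by apply: cvg_indirect_margin => //; exact: order_neq xy.
apply: cvg_indirect_margin => //; apply: (order_neq oxi).
exact: trans_before (before_trans oxi px xy) yq.
Qed.

Lemma next_neq xi x y : strict_total_order xi -> next_in xi x y -> x != y.
Proof. by move=> oxi /next_order; exact: order_neq. Qed.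

Lemma feasible1 v xi : unit_scores v -> admissible_order v xi ->
  feasible_turnovers v xi (fun _ _ => 1).
Proof.
move=> v01 adm; split=> // [x x' /next_order|y y' x /next_order] xx'.
  by have /andP[_ ->] := projected_margin_bounds v01 adm xx'; rewrite lexx.
by move=> _ _; rewrite subrr lexx; have /andP[] := projected_margin_bounds v01 adm xx'.
Qed.

Lemma feasible_conv v xi tau tau' e : 0 <= e <= 1 ->
  feasible_turnovers v xi tau -> feasible_turnovers v xi tau' ->
  feasible_turnovers v xi (fun x y => (1 - e) * tau x y + e * tau' x y).
Proof.
move=> /andP[e0 e1] [sym adj inc] [sym' adj' inc'].
split=> [x y xy|x x' xx'|y y' x yy' xy xy'].
- by rewrite sym // sym'.
- have /andP[? ?] := adj _ _ xx'; have /andP[? ?] := adj' _ _ xx'.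
  by apply/andP; split; nra.
- have /andP[? ?] := inc _ _ _ yy' xy xy'; have /andP[? ?] := inc' _ _ _ yy' xy xy'.
  by apply/andP; split; nra.
Qed.

Lemma order_outside xi x y z : strict_total_order xi -> (x, y) \in xi ->
  (z, x) \in xi \/ (y, z) \in xi -> z != x /\ z != y.
Proof.
move=> oxi xy [zx|yz]; split.
- exact: order_neq zx.
- by apply: (order_neq oxi); exact: order_trans zx xy.
- by rewrite eq_sym; apply: (order_neq oxi); exact: order_trans xy yz.
- by rewrite eq_sym; exact: order_neq yz.
Qed.

(** The difference constraint of a step does not apply at the two ends of that step. The row of [z]
    can therefore be followed only along steps that stay on one side of [z], whence the
    disjunction. *)
Lemma feasible_antitone v xi tau x y z : strict_total_order xi ->
  feasible_turnovers v xi tau -> (x, y) \in xi ->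
  (z, x) \in xi \/ (y, z) \in xi -> tau z y <= tau z x.
Proof.
move=> oxi [_ _ inc]; move: x y; apply: (next_ind oxi) => [x y nxy|x y w nxy yw IH] out.
  have [zx zy] := order_outside oxi (next_order nxy) out.
  by have /andP[] := inc _ _ _ nxy zx zy; rewrite subr_ge0.
have xy := next_order nxy.
have out' : (z, x) \in xi \/ (y, z) \in xi.
  by case: out => [zx|wz]; [left | right; exact: order_trans yw wz].
have [zx zy] := order_outside oxi xy out'.
have tzy : tau z y <= tau z x.
  by have /andP[] := inc _ _ _ nxy zx zy; rewrite subr_ge0.
apply: le_trans tzy; apply: IH.
by case: out => [zx'|wz]; [left; exact: order_trans zx' xy | right].
Qed.

(** Antitonicity places the entry at x y between those of the step entering y and the step leaving
    x, so that the bounds imposed on neighbours reach all pairs. This supplies the compactness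
    needed for minimizers and limits. *)
Lemma feasible_bounds v xi tau x y : unit_scores v -> admissible_order v xi ->
  feasible_turnovers v xi tau -> x != y -> 0 <= tau x y <= 1.
Proof.
move=> v01 adm ftau; have [oxi _] := admissibleP _ _ adm.
have [sym adj _] := ftau.
wlog xy : x y / (x, y) \in xi => [th xy|].
  have [xy1|yx1] := order_total oxi xy; first exact: th.
  by rewrite sym //; apply: th; rewrite // eq_sym.
move=> _; apply/andP; split.
  have [y' y'y xy'] := prev_exists oxi xy.
  have /andP[m0 _] := projected_margin_bounds v01 adm (next_order y'y).
  have /andP[ty _] := adj _ _ y'y.
  apply: le_trans (le_trans m0 ty) _.
  case/orP: xy' => [/eqP->//|xy'].
  rewrite (sym x) ?(order_neq oxi) // (sym y') ?(next_neq oxi y'y) //.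
  apply: (feasible_antitone oxi ftau xy'); right; exact: next_order.
have [x' xx' x'y] := next_exists oxi xy.
have /andP[_ tx] := adj _ _ xx'; apply: le_trans tx.
case/orP: x'y => [/eqP->//|x'y].
apply: (feasible_antitone oxi ftau x'y); left; exact: next_order.
Qed.

Lemma feasible_lim (T : Type) (F : set_system T) {FF : ProperFilter F}
    (v : T -> A -> A -> R) v0 (tau : T -> A -> A -> R) tau0 xi :
  strict_total_order xi ->
  (forall x y, (x, y) \in xi ->
    projected_margin (v t) xi x y @[t --> F] --> projected_margin v0 xi x y) ->
  (forall x y, x != y -> tau t x y @[t --> F] --> tau0 x y) ->
  (\forall t \near F, feasible_turnovers (v t) xi (tau t)) ->
  feasible_turnovers v0 xi tau0.
Proof.
move=> oxi cvgm cvgt ft; split=> [x y xy|x x' xx'|y y' x yy' xy xy'].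
- have yx : y != x by rewrite eq_sym.
  have sym : \forall t \near F, tau t x y = tau t y x.
    by apply: filterS ft => t [sym _ _]; exact: sym.
  apply/le_anti/andP; split.
    by apply: (cvg_le (cvgt _ _ xy) (cvgt _ _ yx)); apply: filterS sym => t ->.
  by apply: (cvg_le (cvgt _ _ yx) (cvgt _ _ xy)); apply: filterS sym => t ->.
- have nxx' := next_neq oxi xx'; have mxx' := cvgm _ _ (next_order xx').
  apply/andP; split.
    apply: (cvg_le mxx' (cvgt _ _ nxx')).
    by apply: filterS ft => t [_ /(_ _ _ xx')/andP[]].
  apply: (cvg_le (cvgt _ _ nxx') (cvg_cst _)).
  by apply: filterS ft => t [_ /(_ _ _ xx')/andP[]].
- have cvgd : tau t x y - tau t x y' @[t --> F] --> tau0 x y - tau0 x y'.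
    by apply: cvgB; exact: cvgt.
  apply/andP; split.
    apply: (cvg_le (cvg_cst (0 : R)) cvgd).
    by apply: filterS ft => t [_ _ /(_ _ _ _ yy' xy xy')/andP[]].
  apply: (cvg_le cvgd (cvgm _ _ (next_order yy'))).
  by apply: filterS ft => t [_ _ /(_ _ _ _ yy' xy xy')/andP[]].
Qed.

Lemma cvg_turnover_distance (T : Type) (F : set_system T) {FF : Filter F}
    (v : T -> A -> A -> R) v0 (tau : T -> A -> A -> R) tau0 :
  (forall x y, v t x y @[t --> F] --> v0 x y) ->
  (forall x y, x != y -> tau t x y @[t --> F] --> tau0 x y) ->
  turnover_distance (v t) (tau t) @[t --> F] --> turnover_distance v0 tau0.
Proof.
move=> cvgv cvgt; apply: cvg_sumr => p pp; rewrite /turnover.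
have cvgd : tau t p.1 p.2 - (v t p.1 p.2 + v t p.2 p.1) @[t --> F] -->
            tau0 p.1 p.2 - (v0 p.1 p.2 + v0 p.2 p.1).
  by apply: cvgB; [exact: cvgt | apply: cvgD].
by rewrite expr2; under eq_cvg do rewrite expr2; exact: cvgM.
Qed.

Definition minimal_turnovers v xi tau := feasible_turnovers v xi tau /\
  forall tau', feasible_turnovers v xi tau' ->
    turnover_distance v tau <= turnover_distance v tau'.

Lemma ultra_turnover_cvg (T : Type) (G : set_system T) {GU : UltraFilter G}
    (tau : T -> A -> A -> R) :
  (\forall t \near G, forall x y, x != y -> 0 <= tau t x y <= 1) ->
  exists tau0, forall x y, x != y -> tau t x y @[t --> G] --> (tau0 x y : R).
Proof.
move=> tau01.
have /choice[tau0 cvg0] : forall p : A * A, exists l : R,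
    p.1 != p.2 -> tau t p.1 p.2 @[t --> G] --> l.
  move=> [x y] /=; have [->|xy] := eqVneq x y; first by exists 0.
  have [|l cvgl] :=
    ultra_bounded_cvg (G := G) (g := fun t => tau t x y) (a := 0) (b := 1).
    by apply: filterS tau01 => t; exact.
  by exists l.
by exists (fun x y => tau0 (x, y)) => x y; exact: (cvg0 (x, y)).
Qed.

Lemma minimal_turnovers_exists v xi : unit_scores v -> admissible_order v xi ->
  exists tau, minimal_turnovers v xi tau.
Proof.
move=> v01 adm; have [oxi _] := admissibleP _ _ adm.
have [||G GU Gf|tau ftau min_tau] :=
  @exists_minimizer R _ (feasible_turnovers v xi) (turnover_distance v) 0.
- by exists (fun _ _ => 1); exact: feasible1.
- by move=> tau _; apply: sumr_ge0 => p _; exact: sqr_ge0.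
- have [|tau0 cvg0] := @ultra_turnover_cvg _ G GU id.
    by apply: filterS Gf => tau ftau x y; exact: feasible_bounds ftau.
  exists tau0; last by apply: cvg_turnover_distance cvg0 => x y; exact: cvg_cst.
  by apply: (@feasible_lim _ G _ (fun=> v) v id) => // x y _; exact: cvg_cst.
by exists tau.
Qed.

Lemma projected_turnover_minimal v xi : unit_scores v -> admissible_order v xi ->
  minimal_turnovers v xi (projected_turnover v xi).
Proof. by move=> v01 adm; exact: (getPex (minimal_turnovers_exists v01 adm)). Qed.

(** Strict convexity: by the parallelogram identity the midpoint, again feasible, has the average of
    the two distances minus a quarter of the squared difference [D]. *)
Lemma minimal_turnovers_unique v xi tau tau' :
  minimal_turnovers v xi tau -> minimal_turnovers v xi tau' ->
  forall x y, x != y -> tau x y = tau' x y.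
Proof.
move=> [ftau min_tau] [ftau' min_tau'] x y xy.
have half : (0 : R) <= 2^-1 <= (1 : R) by rewrite invr_ge0 ler0n invf_le1 ?ltr0n ?ler1n.
have := min_tau _ (feasible_conv half ftau ftau').
have := min_tau' _ ftau; rewrite /turnover_distance => le1 le2.
set D := \sum_(p : A * A | p.1 != p.2) (tau p.1 p.2 - tau' p.1 p.2) ^+ 2.
have D0 : D <= 0.
  move: le1 le2; rewrite (_ : \sum_(p | _) ((1 - 2^-1) * _ + _ - _) ^+ 2 =
    2^-1 * turnover_distance v tau + 2^-1 * turnover_distance v tau' - 4^-1 * D).
    rewrite /turnover_distance; lra.
  rewrite /turnover_distance /D !mulr_sumr -big_split -sumrB; apply: eq_bigr => p _ /=.
  by field.
have : D == 0 by rewrite eq_le D0 sumr_ge0 // => p _; exact: sqr_ge0.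
rewrite psumr_eq0 => [/allP/(_ (x, y))|p _]; last exact: sqr_ge0.
by rewrite mem_index_enum xy /= sqrf_eq0 subr_eq0 => /(_ isT)/eqP.
Qed.

End ProjectedTurnover.

(** * Independence of the admissible order *)

Section Swap.
Context {A : finType}.
Implicit Types (xi : {set A * A}) (s : {perm A}) (x y z : A).

(** The order transported by [s]; for the transposition of two neighbours it is [xi] with that
    single pair reversed. *)
Definition relabel s xi : {set A * A} :=
  [set u | (s u.1, s u.2) \in xi]%SET.

Lemma relabelE s xi x y : ((x, y) \in relabel s xi) = ((s x, s y) \in xi).
Proof. by rewrite inE. Qed.

Lemma before_relabel s xi x y :
  weakly_before (relabel s xi) x y = weakly_before xi (s x) (s y).
Proof. by rewrite /weakly_before relabelE (inj_eq perm_inj). Qed.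

Lemma next_relabel s xi x y : next_in (relabel s xi) x y = next_in xi (s x) (s y).
Proof.
rewrite /next_in relabelE; congr (_ && _); apply/forallP/forallP => nb z.
  by have := nb (s^-1%g z); rewrite !relabelE permKV.
by rewrite !relabelE; exact: nb.
Qed.

Lemma order_relabel s xi : strict_total_order xi -> strict_total_order (relabel s xi).
Proof.
move=> oxi; apply/and3P; split.
- by apply/forallP => x; rewrite relabelE order_irr.
- apply/forallP => x; apply/forallP => y; apply/forallP => z.
  by rewrite !relabelE; apply/implyP => /andP[]; exact: order_trans.
- apply/forallP => x; apply/forallP => y; apply/implyP => xy.
  rewrite !relabelE; apply/orP; apply: order_total => //.
  by rewrite (inj_eq perm_inj).
Qed.

Lemma next_inj_l xi x y y' : strict_total_order xi ->
  next_in xi x y -> next_in xi x y' -> y = y'.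
Proof.
move=> oxi ny ny'; apply/eqP.
have /orP[//|yy'] := next_succ oxi ny (next_order ny').
have /orP[/eqP->//|y'y] := next_succ oxi ny' (next_order ny).
by rewrite (order_asym oxi yy') in y'y.
Qed.

Lemma next_inj_r xi x x' y : strict_total_order xi ->
  next_in xi x y -> next_in xi x' y -> x = x'.
Proof.
move=> oxi ny ny'; apply/eqP.
have /orP[//|xx'] := next_pred oxi ny' (next_order ny).
have /orP[/eqP->//|x'x] := next_pred oxi ny (next_order ny').
by rewrite (order_asym oxi xx') in x'x.
Qed.

Section Adjacent.
Variables (xi : {set A * A}) (p q : A).
Hypotheses (oxi : strict_total_order xi) (npq : next_in xi p q).
Local Notation s := (tperm p q).

Lemma before_next_l z : z != q -> ((z, q) \in xi) = weakly_before xi z p.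
Proof.
move=> zq; apply/idP/idP => [|zp]; first exact: next_pred.
exact: before_trans zp (next_order npq).
Qed.

Lemma before_next_r z : z != p -> ((p, z) \in xi) = weakly_before xi q z.
Proof.
move=> zp; apply/idP/idP => [|qz]; first exact: next_succ.
exact: trans_before (next_order npq) qz.
Qed.

(** Neighbours p and q compare in the same way with any third element. *)
Lemma order_swap x y : (x, y) \in xi -> (x, y) != (p, q) -> (s x, s y) \in xi.
Proof.
move=> xy ne; have pq := next_order npq.
case: (tpermP p q x) xy ne => [->|->|/eqP xp /eqP xq] xy ne.
- have yp : y != p by rewrite eq_sym (order_neq oxi).
  have yq : y != q by apply: contraNneq ne => ->.
  rewrite tpermD 1?eq_sym //.
  by have /orP[/eqP qy|//] := next_succ oxi npq xy; rewrite qy eqxx in yq.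
- have yq : y != q by rewrite eq_sym (order_neq oxi).
  have yp : y != p by apply: contraTneq xy => ->; rewrite (order_asym oxi).
  by rewrite tpermD 1?eq_sym //; exact: order_trans pq xy.
- case: (tpermP p q y) xy ne => [->|->|_ _] xy ne //.
  + exact: order_trans xy pq.
  + by have /orP[/eqP xp'|//] := next_pred oxi npq xy; rewrite xp' eqxx in xp.
Qed.

Lemma before_swap_l r z : z != p ->
  weakly_before xi (s r) z = weakly_before xi r z.
Proof.
move=> zp; have pz : weakly_before xi p z = weakly_before xi q z.
  rewrite -before_next_r // /weakly_before eq_sym (negbTE zp) //.
by case: (tpermP p q r) => [->|->|].
Qed.

Lemma before_swap_r r z : z != q ->
  weakly_before xi z (s r) = weakly_before xi z r.
Proof.
move=> zq; have pz : weakly_before xi z q = weakly_before xi z p.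
  by rewrite -before_next_l // /weakly_before (negbTE zq).
by case: (tpermP p q r) => [->|->|].
Qed.

End Adjacent.
End Swap.

Section Independence.
Context {R : realType} {A : finType}.
Implicit Types (v tau : A -> A -> R) (xi : {set A * A}) (x y z p q : A).

Lemma projected_margin0 v xi p q : admissible_order v xi -> next_in xi p q ->
  indirect_margin v p q = 0 -> projected_margin v xi p q = 0.
Proof.
move=> adm npq m0; have [oxi _] := admissibleP _ _ adm.
apply/le_anti/andP; split.
  by rewrite -m0; apply: projected_margin_le; rewrite /weakly_before eqxx.
apply/projected_margin_geP => r t rp qt; apply: admissible_margin_ge0 adm _.
exact: trans_before (before_trans oxi rp (next_order npq)) qt.
Qed.

Lemma admissible_swap v xi p q : admissible_order v xi -> next_in xi p q ->
  indirect_margin v p q = 0 -> admissible_order v (relabel (tperm p q) xi).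
Proof.
move=> adm npq m0; have [oxi nuxi] := admissibleP _ _ adm.
apply/admissibleP; split; first exact: order_relabel.
apply/fintype.subsetP => -[x y] nuxy; rewrite relabelE.
apply: order_swap => //; first exact: (fintype.subsetP nuxi).
by apply: contraTneq nuxy => -[-> ->]; apply/nuP; rewrite m0 ltxx => -[].
Qed.

(** If x is not p, the initial segment ending at x and the final segment starting at x' each contain
    both of p and q or neither, so both minima range over the same pairs. If x is p, both margins
    vanish. *)
Lemma projected_margin_swap v xi p q x x' :
  admissible_order v xi -> next_in xi p q -> indirect_margin v p q = 0 ->
  next_in xi x x' ->
  projected_margin v (relabel (tperm p q) xi) (tperm p q x) (tperm p q x') =
  projected_margin v xi x x'.
Proof.
move=> adm npq m0 nxx'; have [oxi _] := admissibleP _ _ adm.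
have [xp|xp] := eqVneq x p.
  rewrite xp in nxx' *; rewrite -(next_inj_l oxi npq nxx') tpermL tpermR.
  rewrite !projected_margin0 //; first exact: admissible_swap.
    by rewrite next_relabel tpermL tpermR.
  by rewrite indirect_marginN m0 oppr0.
have x'q : x' != q.
  by apply: contra_neq xp => x'q; rewrite x'q in nxx'; exact: next_inj_r nxx' npq.
apply/le_anti/andP; split; apply/projected_margin_geP => r t rx x't;
  apply: projected_margin_le; move: rx x't;
  by rewrite !before_relabel !tpermK ?(before_swap_l oxi npq) ?(before_swap_r oxi npq).
Qed.

(** The zero margin pinches the difference constraint of the step p q, so that [tau] does not
    distinguish p from q in the row of any third element. *)
Lemma feasible_swap_inv v xi p q tau x y :
  admissible_order v xi -> next_in xi p q -> indirect_margin v p q = 0 ->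
  feasible_turnovers v xi tau -> x != y ->
  tau (tperm p q x) (tperm p q y) = tau x y.
Proof.
move=> adm npq m0 [sym _ inc] xy.
have [oxi _] := admissibleP _ _ adm.
have pq : p != q := next_neq oxi npq.
have inv z : z != p -> z != q -> tau z q = tau z p.
  move=> zp zq; have := inc _ _ _ npq zp zq.
  by rewrite projected_margin0 // => /andP[? ?]; lra.
case: (tpermP p q x) xy => [->|->|/eqP xp /eqP xq] xy;
  case: (tpermP p q y) xy => [->|->|/eqP yp /eqP yq] xy; rewrite ?eqxx // in xy *.
- by rewrite sym // eq_sym.
- by rewrite sym 1?eq_sym // inv // sym // eq_sym.
- by rewrite sym // eq_sym.
- by rewrite sym 1?eq_sym // -inv // sym // eq_sym.
- exact: inv.
- by rewrite inv.
Qed.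

Lemma feasible_swap v xi p q tau :
  admissible_order v xi -> next_in xi p q -> indirect_margin v p q = 0 ->
  feasible_turnovers v xi tau ->
  feasible_turnovers v (relabel (tperm p q) xi) tau.
Proof.
move=> adm npq m0 ftau; have [oxi _] := admissibleP _ _ adm.
have [sym adj inc] := ftau; have inv := feasible_swap_inv adm npq m0 ftau.
have nneq := next_neq oxi.
split=> // [x x'|y y' x]; rewrite next_relabel.
  move=> nxx'; have := projected_margin_swap adm npq m0 nxx'; rewrite !tpermK => ->.
  by rewrite -inv ?adj // -(inj_eq (@perm_inj _ (tperm p q))) nneq.
move=> nyy' xy xy'.
have := projected_margin_swap adm npq m0 nyy'; rewrite !tpermK => ->.
by rewrite -inv // -(inv x y') // inc ?(inj_eq perm_inj).
Qed.

Lemma relabel_tpermK p q xi : relabel (tperm p q) (relabel (tperm p q) xi) = xi.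
Proof. by apply/setP => -[x y]; rewrite !relabelE !tpermK. Qed.

(** The feasible sets of the two orders coincide, the transposition being an involution, and the
    distance does not mention the order. Both uses of [get] thus choose from the same set, which
    gives equality even on the diagonal. *)
Lemma projected_turnover_swap v xi p q :
  admissible_order v xi -> next_in xi p q -> indirect_margin v p q = 0 ->
  projected_turnover v (relabel (tperm p q) xi) = projected_turnover v xi.
Proof.
move=> adm npq m0.
suff eqF : feasible_turnovers v (relabel (tperm p q) xi) = feasible_turnovers v xi.
  by rewrite /projected_turnover eqF.
apply/seteqP; split=> tau; last exact: feasible_swap.
have := @feasible_swap v (relabel (tperm p q) xi) q p tau.
rewrite (tpermC q p) relabel_tpermK; apply.
- exact: admissible_swap.
- by rewrite next_relabel tpermL tpermR.
- by rewrite indirect_marginN m0 oppr0.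
Qed.

Lemma gamma_swap v xi p q x y : unit_scores v ->
  admissible_order v xi -> next_in xi p q -> indirect_margin v p q = 0 ->
  gamma v (relabel (tperm p q) xi) x y = gamma v xi (tperm p q x) (tperm p q y).
Proof.
move=> v01 adm npq m0; have [oxi _] := admissibleP _ _ adm.
have [ft _] := projected_turnover_minimal v01 adm.
have gn a a' : next_in xi a a' ->
    gamma_next v (relabel (tperm p q) xi) (tperm p q a) (tperm p q a') =
    gamma_next v xi a a'.
  move=> naa'; rewrite /gamma_next projected_turnover_swap // projected_margin_swap //.
  by rewrite (feasible_swap_inv adm npq m0 ft) // (next_neq oxi naa').
apply/seteqP; split=> r [a [a' [naa' xa ay ga]]].
  exists (tperm p q a), (tperm p q a'); rewrite next_relabel in naa'.
  rewrite before_relabel in xa; rewrite relabelE in ay; split=> //.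
  by rewrite -gn // !tpermK.
exists (tperm p q a), (tperm p q a'); rewrite next_relabel before_relabel relabelE.
by rewrite !tpermK; split=> //; rewrite gn.
Qed.

Lemma gamma_nextE v xi x y : strict_total_order xi -> next_in xi x y ->
  gamma v xi x y = gamma_next v xi x y.
Proof.
move=> oxi nxy; apply/seteqP; split=> r; last first.
  by exists x, y; split; rewrite // ?(next_order nxy) // /weakly_before eqxx.
case=> a [a' [naa' xa ay ga]].
suff ax : a = x by rewrite ax in naa' ga; rewrite (next_inj_l oxi nxy naa').
have /orP[/eqP//|ax] := next_pred oxi nxy ay.
by move: xa; rewrite weakly_beforeN // ax.
Qed.

Lemma gamma_order_sub v xi x y z : strict_total_order xi -> (y, z) \in xi ->
  gamma v xi x y `<=` gamma v xi x z.
Proof.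
move=> oxi yz r [a [a' [naa' xa ay ga]]]; exists a, a'; split=> //.
exact: order_trans ay yz.
Qed.

Lemma gamma_next_r v xi p q z : strict_total_order xi -> next_in xi p q ->
  (z, p) \in xi -> gamma v xi z q = gamma v xi z p `|` gamma_next v xi p q.
Proof.
move=> oxi npq zp; apply/seteqP; split=> r.
  case=> a [a' [naa' za aq ga]].
  have /orP[/eqP ap|ap] := next_pred oxi npq aq.
    by right; rewrite ap in naa' ga; rewrite (next_inj_l oxi npq naa').
  by left; exists a, a'.
case=> [|gr]; first exact: gamma_order_sub (next_order npq) _.
by exists p, q; split; rewrite // ?(next_order npq) // /weakly_before zp orbT.
Qed.

Lemma gamma_next_l v xi p q z : strict_total_order xi -> next_in xi p q ->
  (q, z) \in xi -> gamma v xi p z = gamma v xi q z `|` gamma_next v xi p q.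
Proof.
move=> oxi npq qz; have pz := order_trans oxi (next_order npq) qz.
apply/seteqP; split=> r.
  case=> a [a' [naa' /orP[/eqP pa|pa] az ga]].
    by right; rewrite -pa in naa' ga; rewrite (next_inj_l oxi npq naa').
  by left; exists a, a'; split=> //; exact: next_succ pa.
case=> [[a [a' [naa' qa az ga]]]|gr].
  exists a, a'; split=> //; apply/orP; right.
  exact: trans_before (next_order npq) qa.
by exists p, q; split; rewrite // /weakly_before eqxx.
Qed.

(* The degenerate interval gamma_pq = {t_pq / 2} lies in the intervals of both
   neighbouring steps, so that a union may include or omit it. *)
Lemma gamma_skip_r v xi p q z : unit_scores v -> admissible_order v xi ->
  next_in xi p q -> indirect_margin v p q = 0 -> (z, p) \in xi ->
  gamma v xi z q = gamma v xi z p.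
Proof.
move=> v01 adm npq m0 zp; have [oxi _] := admissibleP _ _ adm.
have [ft _] := projected_turnover_minimal v01 adm.
rewrite (gamma_next_r _ oxi npq zp); apply/seteqP; split=> [r [//|]|r]; last by left.
have [a nap za] := prev_exists oxi zp.
rewrite /gamma_next projected_margin0 // subr0 addr0 => r_eq.
exists a, p; split; rewrite ?(next_order nap) //; move: r_eq.
rewrite /gamma_next /= !in_itv /= => r_eq; have [sym _ inc] := ft.
have [ap pq] := (next_neq oxi nap, next_neq oxi npq).
have aq : a != q.
  apply: (order_neq oxi); exact: order_trans (next_order nap) (next_order npq).
(* Read at q, the constraint of the step a p says that t_pq lies between t_aq - m_ap and t_aq, and
   t_aq = t_ap. Hence t_pq / 2 belongs to the interval of the step a p. *)
have := inc _ _ q nap; rewrite eq_sym aq eq_sym pq => /(_ isT isT).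
have := feasible_swap_inv adm npq m0 ft ap.
rewrite tpermL tpermD 1?eq_sym // (sym q p) 1?eq_sym // (sym q a) 1?eq_sym //.
by move: r_eq => /andP[? ?] -> /andP[? ?]; apply/andP; split; lra.
Qed.

Lemma gamma_skip_l v xi p q z : unit_scores v -> admissible_order v xi ->
  next_in xi p q -> indirect_margin v p q = 0 -> (q, z) \in xi ->
  gamma v xi p z = gamma v xi q z.
Proof.
move=> v01 adm npq m0 qz; have [oxi _] := admissibleP _ _ adm.
have [ft _] := projected_turnover_minimal v01 adm.
rewrite (gamma_next_l _ oxi npq qz); apply/seteqP; split=> [r [//|]|r]; last by left.
have [b nqb bz] := next_exists oxi qz.
rewrite /gamma_next projected_margin0 // subr0 addr0 => r_eq.
exists q, b; split=> //; first by rewrite /weakly_before eqxx.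
move: r_eq; rewrite /gamma_next /= !in_itv /= => r_eq; have [sym _ inc] := ft.
have [qb pq] := (next_neq oxi nqb, next_neq oxi npq).
have pb : p != b.
  apply: (order_neq oxi); exact: order_trans (next_order npq) (next_order nqb).
have := inc _ _ p nqb pq pb.
have := feasible_swap_inv adm npq m0 ft qb.
rewrite tpermR tpermD //.
by move: r_eq => /andP[? ?] -> /andP[? ?]; apply/andP; split; lra.
Qed.

(** The interval of the pair p q is a single point, so reversing the pair exchanges a maximum and a
    minimum that agree. For every other pair the degenerate step is merely added to the union or
    dropped from it. *)
Lemma projected_scores_swap v xi p q x y : unit_scores v ->
  admissible_order v xi -> next_in xi p q -> indirect_margin v p q = 0 ->
  x != y ->
  projected_scores_along v (relabel (tperm p q) xi) x y =
  projected_scores_along v xi x y.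
Proof.
move=> v01 adm npq m0; have [oxi _] := admissibleP _ _ adm.
have pq := next_order npq; have npq' := next_neq oxi npq.
rewrite /projected_scores_along relabelE !(gamma_swap _ _ v01 adm npq m0).
have skr z : (z, p) \in xi -> _ := gamma_skip_r v01 adm npq m0.
have skl z : (q, z) \in xi -> _ := gamma_skip_l v01 adm npq m0.
have zp_q z : z != p -> z != q -> ((z, q) \in xi) = ((z, p) \in xi).
  by move=> zp zq; rewrite (before_next_l oxi npq) // /weakly_before (negbTE zp).
have p_qz z : z != p -> z != q -> ((p, z) \in xi) = ((q, z) \in xi).
  move=> zp zq; rewrite (before_next_r oxi npq) // /weakly_before.
  by rewrite eq_sym (negbTE zq).
have gpq : gamma v xi p q = [set projected_turnover v xi p q / 2].
  rewrite gamma_nextE // /gamma_next projected_margin0 // subr0 addr0.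
  by rewrite set_itv1.
case: (tpermP p q x) => [->|->|/eqP xp /eqP xq] xy;
  case: (tpermP p q y) xy => [->|->|/eqP yp /eqP yq] xy; rewrite ?eqxx // in xy *.
- by rewrite pq (order_asym oxi pq) gpq sup1 inf1.
- rewrite (p_qz _ yp yq); case: ifP => [/skl->//|/negbT].
  by rewrite order_notin 1?eq_sym // => h; rewrite skr // -zp_q.
- by rewrite pq (order_asym oxi pq) gpq sup1 inf1.
- rewrite (p_qz _ yp yq); case: ifP => [/skl->//|/negbT].
  by rewrite order_notin 1?eq_sym // => h; rewrite skr // -zp_q.
- rewrite (zp_q _ xp xq); case: ifP => [/skr->//|/negbT].
  by rewrite order_notin // => h; rewrite skl // -p_qz.
- rewrite (zp_q _ xp xq); case: ifP => [/skr->//|/negbT].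
  by rewrite order_notin // => h; rewrite skl // -p_qz.
Qed.

(** If every step of [xi] were kept by [xi'], transitivity would give one inclusion and totality the
    other. *)
Lemma order_disagree xi xi' : strict_total_order xi -> strict_total_order xi' ->
  xi != xi' -> exists p q, next_in xi p q /\ (q, p) \in xi'.
Proof.
move=> oxi oxi' ne; apply: contrapT => agree; case/eqP: ne.
have nxi' p q : next_in xi p q -> (p, q) \in xi'.
  move=> npq; apply: contrapT => /negP; rewrite order_notin // => [qp|].
    by apply: agree; exists p, q.
  exact: next_neq npq.
have sub : forall x y, (x, y) \in xi -> (x, y) \in xi'.
  apply: (next_ind oxi) => // x y z /nxi' xy _; exact: order_trans.
apply/setP => -[x y]; apply/idP/idP => [|xy']; first exact: sub.
apply: contrapT => /negP; rewrite order_notin // => [/sub yx'|].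
  by rewrite (order_asym oxi' xy') in yx'.
exact: order_neq xy'.
Qed.

(* Two admissible orders are joined by a chain of transpositions of neighbours
   with zero margin, each of which preserves the projected scores. *)
Lemma projected_scores_indep v xi xi' x y : unit_scores v ->
  admissible_order v xi -> admissible_order v xi' -> x != y ->
  projected_scores_along v xi x y = projected_scores_along v xi' x y.
Proof.
move=> v01 + adm' xy; have [oxi' _] := admissibleP _ _ adm'.
have [n] := ubnP #|xi :\: xi'|; elim: n xi => // n IHn xi lt_n adm.
have [oxi nuxi] := admissibleP _ _ adm.
have [->//|ne] := eqVneq xi xi'.
have [p [q [npq qp']]] := order_disagree oxi oxi' ne.
have pq := next_order npq; have npq' := next_neq oxi npq.
have m0 : indirect_margin v p q = 0.
  apply/le_anti; rewrite (admissible_margin_ge0 adm pq) andbT.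
  by have := admissible_margin_ge0 adm' qp'; rewrite indirect_marginN oppr_ge0.
rewrite -(projected_scores_swap v01 adm npq m0 xy).
apply: IHn; last exact: admissible_swap.
(* The transposition reverses only the pair p q, on which the two orders disagreed, so the set of
   disagreements shrinks strictly. *)
apply: leq_trans (_ : (#|_| < #|xi :\: xi'|)%N) lt_n; apply: proper_card.
apply/properP; split; last first.
  exists (p, q); first by rewrite inE pq andbT (order_asym oxi' qp').
  by rewrite inE relabelE tpermL tpermR (order_asym oxi pq) andbF.
apply/fintype.subsetP => -[a b]; rewrite !inE /= => /andP[nab sab].
rewrite nab /=; have sne : (tperm p q a, tperm p q b) != (p, q).
  apply: contra nab => /eqP[/(canRL (tpermK p q)) -> /(canRL (tpermK p q)) ->].
  by rewrite tpermL tpermR.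
by have := order_swap oxi npq sab sne; rewrite !tpermK.
Qed.

Lemma projected_scoresE v xi x y : unit_scores v -> admissible_order v xi ->
  x != y -> projected_scores v x y = projected_scores_along v xi x y.
Proof.
move=> v01 adm; rewrite /projected_scores; case: pickP => [xi' adm'|none] /=.
  exact: projected_scores_indep.
by rewrite none in adm.
Qed.

End Independence.

(** * Continuity of the projected scores *)

Section ScoreContinuity.
Context {R : realType} {A : finType}.
Implicit Types (tau : A -> A -> R) (xi : {set A * A}) (x y z : A).

Definition step_between xi x y (p : A * A) : bool :=
  [&& next_in xi p.1 p.2, weakly_before xi x p.1 & (p.1, y) \in xi].

Lemma step_between_exists xi x y : strict_total_order xi -> (x, y) \in xi ->
  exists x', step_between xi x y (x, x').
Proof.
move=> oxi xy; have [x' nxx' _] := next_exists oxi xy; exists x'.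
by rewrite /step_between /= nxx' /weakly_before eqxx xy.
Qed.

Lemma step_bounds (v : A -> A -> R) xi x x' : unit_scores v ->
  admissible_order v xi -> next_in xi x x' ->
  [/\ 0 <= projected_margin v xi x x',
      projected_margin v xi x x' <= projected_turnover v xi x x' &
      projected_turnover v xi x x' <= 1].
Proof.
move=> v01 adm nxx'.
have /andP[m0 _] := projected_margin_bounds v01 adm (next_order nxx').
by have [[_ /(_ _ _ nxx')/andP[]]] := projected_turnover_minimal v01 adm.
Qed.

(** A finite maximum over a fixed set of steps passes to the limit term by term. The seed 0 is
    harmless: 0 <= m <= t makes every upper end nonnegative. *)
Lemma projected_scores_max (v : A -> A -> R) xi x y : unit_scores v ->
  admissible_order v xi -> (x, y) \in xi ->
  projected_scores_along v xi x y =
  \big[Num.max/0]_(p : A * A | step_between xi x y p)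
     ((projected_turnover v xi p.1 p.2 + projected_margin v xi p.1 p.2) / 2).
Proof.
move=> v01 adm xy; have [oxi _] := admissibleP _ _ adm.
rewrite /projected_scores_along xy.
have in_gamma p : step_between xi x y p -> gamma v xi x y
    ((projected_turnover v xi p.1 p.2 + projected_margin v xi p.1 p.2) / 2).
  case/and3P => npp' xp py; exists p.1, p.2; split=> //.
  have [m0 _ _] := step_bounds v01 adm npp'.
  by rewrite /gamma_next /= in_itv /= lexx andbT; lra.
have ub r : gamma v xi x y r -> r <= \big[Num.max/0]_(p : A * A | step_between xi x y p)
     ((projected_turnover v xi p.1 p.2 + projected_margin v xi p.1 p.2) / 2).
  case=> p [p' [npp' xp py]]; rewrite /gamma_next /= in_itv /= => /andP[_ r_le].
  apply: le_trans r_le _; apply: (le_bigmax_cond _ (j := (p, p'))).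
  by rewrite /step_between /= npp' xp.
have hub : has_ubound (gamma v xi x y) by eexists => r; exact: ub.
have [x' sx] := step_between_exists oxi xy.
apply/le_anti/andP; split; first by apply: ge_sup => //; eexists; exact: in_gamma sx.
apply/bigmax_leP; split=> [|p /in_gamma gp]; last exact: ub_le_sup.
apply: le_trans (ub_le_sup hub (in_gamma _ sx)); move: sx => /and3P[/= nxx' _ _].
have [? ? _] := step_bounds v01 adm nxx'; lra.
Qed.

(** The seed 1 exceeds every term, since (t - m) / 2 is at most 1 / 2. *)
Lemma projected_scores_min (v : A -> A -> R) xi x y : unit_scores v ->
  admissible_order v xi -> (x, y) \in xi ->
  projected_scores_along v xi y x =
  \big[Num.min/1]_(p : A * A | step_between xi x y p)
     ((projected_turnover v xi p.1 p.2 - projected_margin v xi p.1 p.2) / 2).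
Proof.
move=> v01 adm xy; have [oxi _] := admissibleP _ _ adm.
rewrite /projected_scores_along (order_asym oxi xy).
have in_gamma p : step_between xi x y p -> gamma v xi x y
    ((projected_turnover v xi p.1 p.2 - projected_margin v xi p.1 p.2) / 2).
  case/and3P => npp' xp py; exists p.1, p.2; split=> //.
  have [m0 _ _] := step_bounds v01 adm npp'.
  by rewrite /gamma_next /= in_itv /= lexx /=; lra.
have lb r : gamma v xi x y r -> \big[Num.min/1]_(p : A * A | step_between xi x y p)
     ((projected_turnover v xi p.1 p.2 - projected_margin v xi p.1 p.2) / 2) <= r.
  case=> p [p' [npp' xp py]]; rewrite /gamma_next /= in_itv /= => /andP[le_r _].
  apply: le_trans le_r; apply: (bigmin_le_cond _ (j := (p, p'))).
  by rewrite /step_between /= npp' xp.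
have hlb : has_lbound (gamma v xi x y) by eexists => r; exact: lb.
have [x' sx] := step_between_exists oxi xy.
apply/le_anti/andP; split; last by apply: lb_le_inf => //; eexists; exact: in_gamma sx.
apply/bigmin_geP; split=> [|p /in_gamma gp]; last exact: ge_inf.
apply: (le_trans (ge_inf hlb (in_gamma _ sx))); move: sx => /and3P[/= nxx' _ _].
have [? ? ?] := step_bounds v01 adm nxx'; lra.
Qed.

(** A margin that is positive at [v0] is positive nearby, so [nu] can only grow near [v0]. *)
Lemma admissible_lim (T : Type) (F : set_system T) {FF : ProperFilter F}
    (v : T -> A -> A -> R) v0 xi :
  (\forall t \near F, unit_scores (v t)) -> unit_scores v0 ->
  (forall a b, v t a b @[t --> F] --> v0 a b) ->
  (\forall t \near F, admissible_order (v t) xi) -> admissible_order v0 xi.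
Proof.
move=> v01 v001 cvgv adm; apply/admissibleP; split.
  by have [t /admissibleP[]] := filter_ex adm.
apply/fintype.subsetP => -[x y] /nuP[xy m0].
have mt : \forall t \near F, 0 < indirect_margin (v t) x y.
  exact: (cvgr_gt _ (cvg_indirect_margin v01 v001 cvgv xy)).
have [t [/admissibleP[_ /fintype.subsetP sub] mt0]] := filter_ex (filterI adm mt).
by apply: sub; apply/nuP.
Qed.

(* Mixing a family feasible for the scores v0 with the constant family 1 in a
   proportion [e] that bounds the relative variations of the margins makes it
   feasible for v. *)
Lemma feasible_perturb (v v0 : A -> A -> R) xi tau e : unit_scores v ->
  admissible_order v xi -> 
  (forall x x', next_in xi x x' ->
     0 <= projected_margin v0 xi x x' <= 1 /\
     (projected_margin v0 xi x x' - projected_margin v xi x x') /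
       projected_margin v0 xi x x' <= e /\
     (projected_margin v xi x x' - projected_margin v0 xi x x') /
       (1 - projected_margin v0 xi x x') <= e) ->
  0 <= e <= 1 -> feasible_turnovers v0 xi tau ->
  feasible_turnovers v xi (fun x y => (1 - e) * tau x y + e).
Proof.
move=> v01 adm me /andP[e0 e1] [sym adj inc].
have le1 x x' : next_in xi x x' ->
    (1 - e) * projected_margin v0 xi x x' <= projected_margin v xi x x'.
  move=> nxx'; have [/andP[m0 _] [+ _]] := me _ _ nxx'.
  have /andP[m0' _] := projected_margin_bounds v01 adm (next_order nxx').
  (* At margin 0 the quotient is 0 by convention and carries no information, but the claim reduces
     to nonnegativity of the nearby margin. Margin 1 is treated likewise below, through the upper
     bound 1. *)
  move: m0; rewrite le_eqVlt => /orP[/eqP<-|m0]; first by rewrite mulr0.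
  rewrite ler_pdivrMr //; lra.
have le2 x x' : next_in xi x x' ->
    projected_margin v xi x x' <= (1 - e) * projected_margin v0 xi x x' + e.
  move=> nxx'; have [/andP[_ m1] [_ +]] := me _ _ nxx'.
  have /andP[_ m1'] := projected_margin_bounds v01 adm (next_order nxx').
  move: m1; rewrite le_eqVlt => /orP[/eqP->|m1]; first by move=> _; lra.
  rewrite ler_pdivrMr ?subr_gt0 //; lra.
split=> [x y xy|x x' nxx'|y y' x nyy' xy xy'].
- by rewrite sym.
- have /andP[? ?] := adj _ _ nxx'; have := le2 _ _ nxx' => ?.
  apply/andP; split; nra.
- have /andP[? ?] := inc _ _ _ nyy' xy xy'; have := le1 _ _ nyy' => ?.
  apply/andP; split; nra.
Qed.

Lemma cvg_projected_turnover (T : Type) (G : set_system T) {GU : UltraFilter G}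
    (v : T -> A -> A -> R) v0 xi x y :
  (\forall t \near G, unit_scores (v t)) -> unit_scores v0 ->
  (forall a b, v t a b @[t --> G] --> v0 a b) ->
  (\forall t \near G, admissible_order (v t) xi) -> x != y ->
  projected_turnover (v t) xi x y @[t --> G] --> projected_turnover v0 xi x y.
Proof.
move=> v01 v001 cvgv adm xy.
have adm0 : admissible_order v0 xi by exact: admissible_lim adm.
have [oxi _] := admissibleP _ _ adm0.
have [|tau0 cvg0] :=
  ultra_turnover_cvg (G := G) (tau := fun t => projected_turnover (v t) xi).
  apply: filterS2 v01 adm => t vt01 admt a b.
  exact: feasible_bounds (projected_turnover_minimal vt01 admt).1.
have cvgm a b : (a, b) \in xi ->
    projected_margin (v t) xi a b @[t --> G] --> projected_margin v0 xi a b.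
  by move=> ab; exact: cvg_projected_margin.
suff min0 : minimal_turnovers v0 xi tau0.
  rewrite -(minimal_turnovers_unique min0 (projected_turnover_minimal v001 adm0) xy).
  exact: cvg0.
split=> [|tau' ftau'].
  apply: feasible_lim cvgm cvg0 _ => //.
  apply: filterS2 v01 adm => t vt01 admt.
  by have [] := projected_turnover_minimal vt01 admt.
pose m0 (p : A * A) := projected_margin v0 xi p.1 p.2.
pose m t (p : A * A) := projected_margin (v t) xi p.1 p.2.
(* The least nonnegative proportion that meets the requirements of [feasible_perturb]. Its
   denominators depend on [v0] only, so it tends to 0; where they vanish the quotients are 0. *)
pose e t := \big[Num.max/0]_(p : A * A | next_in xi p.1 p.2)
  Num.max ((m0 p - m t p) / m0 p) ((m t p - m0 p) / (1 - m0 p)).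
have e_cvg : e t @[t --> G] --> (0 : R).
  suff e_cvg : e t @[t --> G] --> \big[Num.max/(0 : R)]_(p : A * A | next_in xi p.1 p.2)
      Num.max ((m0 p - m0 p) / m0 p) ((m0 p - m0 p) / (1 - m0 p)).
    move: e_cvg; rewrite big1_idem //; first exact: maxxx.
    by move=> p _; rewrite subrr !mul0r maxxx.
  apply: cvg_bigmax; first exact: cvg_cst.
  move=> p /next_order/cvgm cvgmp; apply: cvg_maxr; apply: cvgM; try exact: cvg_cst.
    by apply: cvgB; [exact: cvg_cst|].
  by apply: cvgB; [|exact: cvg_cst].
have e0 t : 0 <= e t by exact: bigmax_ge_id.
have e1 : \forall t \near G, e t < 1 by exact: (cvgr_lt _ e_cvg).
have cvgl : turnover_distance (v t) (projected_turnover (v t) xi) @[t --> G] -->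
    turnover_distance v0 tau0 by exact: cvg_turnover_distance.
have cvgr : turnover_distance (v t) (fun x y => (1 - e t) * tau' x y + e t) @[t --> G]
    --> turnover_distance v0 (fun x y => (1 - 0) * tau' x y + 0).
  apply: cvg_turnover_distance => // a b ab; apply: cvgD => //.
  by apply: cvgM; [apply: cvgB => //|]; exact: cvg_cst.
have -> : turnover_distance v0 tau' =
          turnover_distance v0 (fun x y => (1 - 0) * tau' x y + 0).
  by apply: eq_bigr => p _; rewrite subr0 mul1r addr0.
apply: (cvg_le cvgl cvgr).
apply: filterS3 v01 adm e1 => t vt01 admt e1t.
have [_] := projected_turnover_minimal vt01 admt; apply.
apply: feasible_perturb ftau' => //; last by rewrite e0 ltW.
move=> a b nab; split; first exact: projected_margin_bounds (next_order nab).
have := @le_bigmax_cond _ _ _ 0 (a, b) (fun p => next_in xi p.1 p.2)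
  (fun p => Num.max ((m0 p - m t p) / m0 p) ((m t p - m0 p) / (1 - m0 p))) nab.
by rewrite ge_max => /andP[].
Qed.

Lemma cvg_projected_scores (T : Type) (F : set_system T) {FF : Filter F}
    (v : T -> A -> A -> R) v0 x y :
  (\forall t \near F, unit_scores (v t)) -> unit_scores v0 ->
  (forall a b, v t a b @[t --> F] --> v0 a b) -> x != y ->
  projected_scores (v t) x y @[t --> F] --> projected_scores v0 x y.
Proof.
move=> v01F v001 cvgvF xy; apply: cvg_ultra => G GU FG.
have v01 : \forall t \near G, unit_scores (v t) by exact: FG.
have cvgv a b : v t a b @[t --> G] --> v0 a b.
  exact: cvg_trans (cvg_app _ FG) (cvgvF a b).
have [xi xi_t] := @ultra_fin _ _ G GU
  (fun t => odflt finset.set0 [pick xi | admissible_order (v t) xi]).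
have adm : \forall t \near G, admissible_order (v t) xi.
  apply: filterS2 v01 xi_t => t vt01 <-; case: pickP => [//|none].
  by have [xi'] := admissible_exists vt01; rewrite none.
have adm0 : admissible_order v0 xi by exact: admissible_lim adm.
have [oxi _] := admissibleP _ _ adm0.
rewrite (projected_scoresE v001 adm0 xy).
have cvgs p : next_in xi p.1 p.2 ->
    projected_turnover (v t) xi p.1 p.2 @[t --> G] -->
      projected_turnover v0 xi p.1 p.2 /\
    projected_margin (v t) xi p.1 p.2 @[t --> G] -->
      projected_margin v0 xi p.1 p.2.
  move=> np; split; last by apply: cvg_projected_margin => //; exact: next_order.
  by apply: cvg_projected_turnover => //; exact: next_neq np.
have eq_t : \forall t \near G,
    projected_scores (v t) x y = projected_scores_along (v t) xi x y.
  by apply: filterS2 v01 adm => t vt01 admt; exact: projected_scoresE.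
have [xyi|yxi] := order_total oxi xy.
  rewrite (projected_scores_max v001 adm0 xyi).
  apply: (@cvg_trans _ ((fun t => \big[Num.max/0]_(p : A * A | step_between xi x y p)
     ((projected_turnover (v t) xi p.1 p.2 +
        projected_margin (v t) xi p.1 p.2) / 2)) @ G)).
    apply: near_eq_cvg; apply: filterS3 eq_t v01 adm => t -> vt01 admt.
    by rewrite (projected_scores_max vt01 admt xyi).
  apply: cvg_bigmax; first exact: cvg_cst.
  move=> p /and3P[/cvgs[ct cm] _ _]; apply: cvgM; last exact: cvg_cst.
  exact: cvgD.
rewrite (projected_scores_min v001 adm0 yxi).
apply: (@cvg_trans _ ((fun t => \big[Num.min/1]_(p : A * A | step_between xi y x p)
   ((projected_turnover (v t) xi p.1 p.2 -
      projected_margin (v t) xi p.1 p.2) / 2)) @ G)).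
  apply: near_eq_cvg; apply: filterS3 eq_t v01 adm => t -> vt01 admt.
  by rewrite (projected_scores_min vt01 admt yxi).
apply: cvg_bigmin; first exact: cvg_cst.
move=> p /and3P[/cvgs[ct cm] _ _]; apply: cvgM; last exact: cvg_cst.
exact: cvgB.
Qed.

End ScoreContinuity.

(** * A source of positive scores *)

Section Positivity.
Context {R : realType} {A : finType}.
Implicit Types (v : A -> A -> R) (xi : {set A * A}) (x y : A).

Lemma projected_scores_ge0 v x y : unit_scores v -> x != y ->
  0 <= projected_scores v x y.
Proof.
move=> v01 xy; have [xi adm] := admissible_exists v01.
have [oxi _] := admissibleP _ _ adm; rewrite (projected_scoresE v01 adm xy).
have [xyi|yxi] := order_total oxi xy.
  by rewrite projected_scores_max //; exact: bigmax_ge_id.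
rewrite projected_scores_min //; apply: le_bigmin => // p /and3P[npp' _ _].
have [? ? ?] := step_bounds v01 adm npp'; lra.
Qed.

(* If the first step had upper end 0, all projected turnovers and margins would
   vanish; constant families would then be feasible, and a small positive
   constant would be closer to the turnovers than 0. *)
Lemma projected_scores_source v : unit_scores v -> ~~ zero_offdiag v ->
  exists x1, forall y, y != x1 -> 0 < projected_scores v x1 y.
Proof.
move=> v01; rewrite negb_forall => /existsP[x0].
rewrite negb_forall => /existsP[y0]; rewrite negb_imply => /andP[x0y0 v0].
have [xi adm] := admissible_exists v01; have [oxi _] := admissibleP _ _ adm.
have [x1 first_x1] := order_first x0 oxi; exists x1 => y yx1.
have x1y := first_x1 _ yx1; have x1_y : x1 != y by rewrite eq_sym.
rewrite (projected_scoresE v01 adm x1_y) projected_scores_max //.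
have [x' nx' x'y] := next_exists oxi x1y.
have [m0 mt t1] := step_bounds v01 adm nx'.
suff t0 : 0 < projected_turnover v xi x1 x'.
  apply: (@lt_le_trans _ _
    ((projected_turnover v xi x1 x' + projected_margin v xi x1 x') / 2)).
    lra.
  apply: (le_bigmax_cond _ (j := (x1, x'))).
  by rewrite /step_between /= nx' x1y /weakly_before eqxx.
rewrite ltNge; apply/negP => t0.
have [ftau min_tau] := projected_turnover_minimal v01 adm.
move: ftau min_tau t0 mt {t1}; set tau := projected_turnover v xi.
move=> ftau min_tau t0 mt; have [sym adj inc] := ftau.
(* The entry of the first step dominates all others: antitonicity moves an entry a b to x1 b along
   the row of b, then to x1 x' along the row of x1. *)
have tx1 b : b != x1 -> tau x1 b <= 0.
  move=> bx1; apply: le_trans t0.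
  have /orP[/eqP->//|x'b] := next_succ oxi nx' (first_x1 _ bx1).
  by apply: (feasible_antitone oxi ftau x'b); left; exact: next_order.
have tle a b : (a, b) \in xi -> tau a b <= 0.
  move=> ab; have ab' := order_neq oxi ab.
  have [->|ax1] := eqVneq a x1.
    apply: tx1; apply: contraTneq ab => ->; case: (eqVneq a x1) => [->|ax1].
      by rewrite order_irr.
    by rewrite (order_asym oxi (first_x1 _ ax1)).
  have bx1 : b != x1.
    by apply: contraTneq ab => ->; rewrite (order_asym oxi (first_x1 _ ax1)).
  rewrite sym //; apply: (@le_trans _ _ (tau b x1)).
    by apply: (feasible_antitone oxi ftau (first_x1 _ ax1)); right.
  by rewrite sym //; exact: tx1.
have tau0 a b : a != b -> tau a b = 0.
  move=> ab; apply/le_anti; have /andP[-> _] := feasible_bounds v01 adm ftau ab.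
  have [/tle->//|ba] := order_total oxi ab.
  by rewrite sym // tle.
have margin0 a b : next_in xi a b -> projected_margin v xi a b = 0.
  move=> nab; have [ma mat _] := step_bounds v01 adm nab.
  by apply/le_anti; rewrite ma andbT -(tau0 a b) // (next_neq oxi nab).
pose S := \sum_(p : A * A | p.1 != p.2) turnover v p.1 p.2.
pose n := \sum_(p : A * A | p.1 != p.2) (1 : R).
have turn0 a b : a != b -> 0 <= turnover v a b.
  move=> ab; have ba : b != a by rewrite eq_sym.
  by apply: addr_ge0; [have /andP[] := v01 _ _ ab | have /andP[] := v01 _ _ ba].
have S0 : 0 < S.
  rewrite /S (bigD1 (x0, y0)) //=; apply: ltr_wpDr.
    by apply: sumr_ge0 => p /andP[pp _]; exact: turn0.
  have y0x0 : y0 != x0 by rewrite eq_sym.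
  have /andP[v00 _] := v01 _ _ x0y0; have /andP[v00' _] := v01 _ _ y0x0.
  by rewrite /turnover; apply: ltr_wpDr => //; rewrite lt_neqAle eq_sym v0.
have n0 : 0 <= n by apply: sumr_ge0.
have nS : 0 < n + S by lra.
(* On the constant family c the distance changes by c ^+ 2 * n - 2 * c * S, negative for c * n < 2 *
   S. This value qualifies and is at most 1, as feasibility demands. *)
pose c := S / (n + S).
have cE : c * (n + S) = S by rewrite /c divfK // gt_eqF.
have c0 : 0 < c by rewrite divr_gt0.
have c1 : c <= 1 by rewrite ler_pdivrMr // mul1r; lra.
have fc : feasible_turnovers v xi (fun _ _ => c).
  split=> // [a b nab|a b z nab _ _]; rewrite margin0 //; first by rewrite ltW.
  by rewrite subrr lexx.
have := min_tau _ fc.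
have -> : turnover_distance v tau =
    \sum_(p : A * A | p.1 != p.2) (turnover v p.1 p.2) ^+ 2.
  by apply: eq_bigr => p pp; rewrite tau0 // sub0r sqrrN.
have -> : turnover_distance v (fun _ _ => c) = c ^+ 2 * n - 2 * c * S +
    \sum_(p : A * A | p.1 != p.2) (turnover v p.1 p.2) ^+ 2.
  rewrite /turnover_distance /n /S !mulr_sumr -sumrB -big_split /=.
  by apply: eq_bigr => p _; ring.
nra.
Qed.

End Positivity.

(** * Uniqueness of the fraction-like rates *)

Lemma connect_exit (A : finType) (e : rel A) (S : {set A}) x y :
  connect e x y -> x \in S -> y \notin S ->
  exists a b, [/\ a \in S, b \notin S & e a b].
Proof.
case/connectP => s; elim: s x => [|z s IHs] x /=; first by move=> _ -> ->.
case/andP => xz path_s last_s xS yS; have [zS|zS] := boolP (z \in S).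
  exact: IHs path_s last_s zS yS.
by exists x, z.
Qed.

Section FractionRates.
Context {R : realType} {A : finType}.
Implicit Types (w : A -> A -> R) (phi psi : A -> R) (X Y Z : {set A}) (x y : A).

Definition nonneg_scores w := forall x y, x != y -> 0 <= w x y.

(** The source reaches everything, so the elements that reach it form its strong component, which no
    outside element reaches. *)
Lemma top_dominant_exists w x1 : (forall y, y != x1 -> 0 < w x1 y) ->
  exists X, top_dominant_component w X.
Proof.
move=> source.
have reach y : positive_path w x1 y.
  have [->|yx1] := eqVneq y x1; first exact: connect0.
  by apply: connect1; rewrite eq_sym yx1 source.
exists [set z | positive_path w z x1]%SET; apply/and4P; split.
- by apply/set0Pn; exists x1; rewrite inE; exact: connect0.
- apply/forall_inP => x; rewrite inE => xx1; apply/forall_inP => y _.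
  by apply/implyP => _; exact: connect_trans xx1 (reach y).
- apply/forall_inP => x; rewrite inE => xx1; apply/forallP => y.
  by apply/implyP => _; exact: connect_trans xx1 (reach y).
- apply/forall_inP => x; rewrite inE => xx1; apply/forallP => y.
  rewrite inE; apply/implyP; apply: contra => yx; exact: connect_trans yx xx1.
Qed.

Section TopComponent.
Variables (w : A -> A -> R) (X : {set A}).
Hypotheses (w_ge0 : nonneg_scores w) (topX : top_dominant_component w X).

Lemma top_nonempty : exists x, x \in X.
Proof. by case/and4P: topX => /set0Pn. Qed.

Lemma top_reach x y : x \in X -> positive_path w x y.
Proof.
case/and4P: topX => _ /forall_inP inX /forall_inP outX _ xX.
have [->|xy] := eqVneq x y; first exact: connect0.
have [yX|yX] := boolP (y \in X).
  by have /forall_inP/(_ y yX) := inX x xX; rewrite xy.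
by have /forallP/(_ y) := outX x xX; rewrite yX.
Qed.

Lemma top_cut x y : x \in X -> y \notin X -> w y x = 0.
Proof.
case/and4P: topX => _ _ _ /forall_inP noX xX yX.
have /forallP/(_ y) := noX x xX; rewrite yX => /= nyx.
have yx : y != x by apply: contraNneq yX => ->.
apply/le_anti; rewrite w_ge0 // andbT leNgt; apply: contra nyx => w0.
by apply: connect1; rewrite yx.
Qed.

Lemma top_cut_crossing Z x y : x \in X -> x \in Z -> y \notin Z ->
  exists a b, [/\ a \in Z, b \notin Z, a != b & 0 < w a b].
Proof.
move=> xX xZ yZ.
have [a [b [aZ bZ /andP[ab wab]]]] := connect_exit (top_reach y xX) xZ yZ.
by exists a, b.
Qed.

(** X reaches z, so from an element of X outside Z a positive path would have to enter Z. *)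
Lemma top_sub Z z : z \in Z -> (forall x y, x \in Z -> y \notin Z -> w y x = 0) ->
  X \subset Z.
Proof.
move=> zZ closedZ; apply/fintype.subsetP => x xX; apply: contrapT => /negP xZ.
have [||a [b [+ + _ +]]] := top_cut_crossing (Z := ~: Z) (y := z) xX.
- by rewrite inE.
- by rewrite inE zZ.
by rewrite !inE negbK => aZ bZ; rewrite (closedZ b a) ?ltxx.
Qed.

(* At a vertex maximizing phi / psi every term of the rate equation for phi
   dominates the one for psi, so that the set of maximizers cannot be entered
   by a positive score. *)
Lemma fraction_rates_unique f phi psi :
  is_fraction_rates w f X phi -> is_fraction_rates w f X psi -> phi = psi.
Proof.
move=> [phi_out phi_pos phi_sum phi_eq] [psi_out psi_pos psi_sum psi_eq].
have [x0 x0X] := top_nonempty.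
pose ratio x := phi x / psi x.
have [m mX max_m] := @arg_maxP _ _ _ x0 (mem X) ratio x0X.
have {}mX : m \in X by [].
set rho := ratio m in max_m.
have le_rho x : x \in X -> phi x <= rho * psi x.
  by move=> xX; rewrite -ler_pdivrMr ?psi_pos //; exact: max_m.
suff eq_rho x : x \in X -> phi x = rho * psi x.
  have rho1 : rho = 1.
    have f0 : 0 < f.
      rewrite -psi_sum (bigD1 x0) //=; apply: ltr_wpDr; last exact: psi_pos.
      by apply: sumr_ge0 => x /andP[xX _]; exact/ltW/psi_pos.
    apply: (mulIf (lt0r_neq0 f0)); rewrite mul1r -{1}psi_sum mulr_sumr -phi_sum.
    by apply/esym; exact: eq_bigr.
  apply/funext => x; have [xX|xX] := boolP (x \in X).
    by rewrite eq_rho // rho1 mul1r.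
  by rewrite phi_out // psi_out.
move=> xX; pose M := [set x in X | phi x == rho * psi x]%SET.
apply: contrapT => /eqP ne.
have mM : m \in M.
  have psim : psi m != 0 by rewrite gt_eqF // psi_pos.
  by rewrite inE mX /= /rho /ratio divfK.
have [||a [b [+ + ab wab]]] := top_cut_crossing (Z := ~: M) (y := m) xX.
- by rewrite !inE xX.
- by rewrite inE mM.
rewrite !inE negbK => aM /andP[bX /eqP bM].
have aX : a \in X.
  by apply: contraTT wab => aX; rewrite (top_cut bX aX) ltxx.
have phi_a : phi a < rho * psi a.
  by rewrite lt_neqAle le_rho // andbT; move: aM; rewrite aX.
have tba : 0 < turnover w b a.
  by apply: ltr_wpDl => //; apply: w_ge0; rewrite eq_sym.
have : \sum_(y in X | y != b) turnover w b y * (psi b / (psi b + psi y)) <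
       \sum_(y in X | y != b) turnover w b y * (phi b / (phi b + phi y)).
  have le_term y : y \in X -> psi b / (psi b + psi y) <= phi b / (phi b + phi y).
    move=> yX; have [? ? ? ?] : [/\ 0 < psi b, 0 < psi y, 0 < phi b & 0 < phi y].
      by split; rewrite ?psi_pos ?phi_pos.
    rewrite ler_pdivrMr ?addr_gt0 // mulrAC ler_pdivlMr ?addr_gt0 //.
    have := le_rho _ yX; rewrite bM => le_y; nra.
  rewrite (bigD1 a) ?aX ?ab //= [X in _ < X](bigD1 a) ?aX ?ab //=.
  apply: ltr_leD.
    rewrite ltr_pM2l //.
    have [? ? ? ?] : [/\ 0 < psi b, 0 < psi a, 0 < phi b & 0 < phi a].
      by split; rewrite ?psi_pos ?phi_pos.
    rewrite ltr_pdivrMr ?addr_gt0 // mulrAC ltr_pdivlMr ?addr_gt0 //.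
    rewrite bM in phi_a *; nra.
  apply: ler_sum => y /andP[/andP[yX yb] _]; apply: ler_wpM2l; last exact: le_term.
  by apply: addr_ge0; apply: w_ge0 => //; rewrite eq_sym.
by rewrite psi_eq // phi_eq // ltxx.
Qed.

End TopComponent.
End FractionRates.

(** * Existence of the fraction-like rates *)

Section Existence.
Context {R : realType} {A : finType}.
Variables (w : A -> A -> R) (X : {set A}).
Hypotheses (w_ge0 : nonneg_scores w) (topX : top_dominant_component w X).
Implicit Types (phi psi : A -> R) (x y : A).

(* Minus the logarithm of the likelihood of the pairwise results w when x beats
   y with probability phi x / (phi x + phi y). *)
Definition neg_log_likelihood phi : R :=
  \sum_(x in X) \sum_(y in X | y != x) w x y * (ln (phi x + phi y) - ln (phi x)).

Local Notation h := neg_log_likelihood.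

Lemma ln_addB_ge0 (a b : R) : 0 < a -> 0 < b -> 0 <= ln (a + b) - ln a.
Proof.
by move=> a0 b0; rewrite subr_ge0 ler_ln ?posrE ?addr_gt0 // lerDl ltW.
Qed.

Lemma ln_sub_le (a b : R) : 0 < a -> 0 < b -> ln a - ln b <= (a - b) / b.
Proof.
move=> a0 b0; rewrite -ln_div ?posrE //.
have -> : a / b = 1 + (a - b) / b by field; rewrite gt_eqF.
apply: le_ln1Dx; rewrite ltr_pdivlMr //; lra.
Qed.

Lemma likelihood_term_ge0 phi x y : {in X, forall z, 0 < phi z} ->
  x \in X -> (y \in X) && (y != x) ->
  0 <= w x y * (ln (phi x + phi y) - ln (phi x)).
Proof.
move=> phi0 xX /andP[yX yx]; apply: mulr_ge0; first by apply: w_ge0; rewrite eq_sym.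
by apply: ln_addB_ge0; exact: phi0.
Qed.

Lemma likelihood_ge0 phi : {in X, forall z, 0 < phi z} -> 0 <= h phi.
Proof.
move=> phi0; apply: sumr_ge0 => x xX; apply: sumr_ge0 => y; exact: likelihood_term_ge0.
Qed.

Lemma likelihood_ge_term phi x y : {in X, forall z, 0 < phi z} ->
  x \in X -> y \in X -> y != x ->
  w x y * (ln (phi x + phi y) - ln (phi x)) <= h phi.
Proof.
move=> phi0 xX yX yx; rewrite /h (bigD1 x) //= (bigD1 y) ?yX //=.
rewrite -addrA lerDl; apply: addr_ge0.
  by apply: sumr_ge0 => z /andP[zy _]; exact: likelihood_term_ge0.
by apply: sumr_ge0 => z /andP[zX _]; apply: sumr_ge0 => t; exact: likelihood_term_ge0.
Qed.

Lemma likelihood_scale phi c : 0 < c -> {in X, forall z, 0 < phi z} ->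
  h (fun x => c * phi x) = h phi.
Proof.
move=> c0 phi0; apply: eq_bigr => x xX; apply: eq_bigr => y /andP[yX _].
have [px py] := (phi0 _ xX, phi0 _ yX).
rewrite -mulrDr !lnM ?posrE ?addr_gt0 //; congr (_ * _); ring.
Qed.

Lemma eq_likelihood phi psi : {in X, phi =1 psi} -> h phi = h psi.
Proof.
move=> eq_phi; apply: eq_bigr => x xX; apply: eq_bigr => y /andP[yX _].
by rewrite !eq_phi.
Qed.

Lemma cvg_likelihood (T : Type) (F : set_system T) {FF : Filter F}
    (phi : T -> A -> R) phi0 : {in X, forall z, 0 < phi0 z} ->
  (forall x, phi t x @[t --> F] --> phi0 x) ->
  h (phi t) @[t --> F] --> h phi0.
Proof.
move=> phi00 cvgphi; apply: cvg_sumr => x xX; apply: cvg_sumr => y /andP[yX yx].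
apply: cvgM; first exact: cvg_cst.
apply: cvgB.
  apply: (cvg_comp _ _ (cvgD (cvgphi x) (cvgphi y))).
  by apply: continuous_ln; rewrite addr_gt0 ?phi00.
by apply: (cvg_comp _ _ (cvgphi x)); apply: continuous_ln; exact: phi00.
Qed.

(** Separates the terms that depend on the coordinate at x from the rest, which cancels when only
    that coordinate is varied. *)
Lemma likelihood_split phi x : x \in X ->
  h phi = \sum_(y in X | y != x)
     (turnover w x y * ln (phi x + phi y) - w x y * ln (phi x) - w y x * ln (phi y)) +
   \sum_(y in X | y != x) \sum_(z | [&& z \in X, z != y & z != x])
      w y z * (ln (phi y + phi z) - ln (phi y)).
Proof.
move=> xX; rewrite /h (bigD1 x) //=.
have -> : \sum_(y in X | y != x) \sum_(z in X | z != y)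
      w y z * (ln (phi y + phi z) - ln (phi y)) =
    \sum_(y in X | y != x) (w y x * (ln (phi y + phi x) - ln (phi y)) +
     \sum_(z | [&& z \in X, z != y & z != x])
      w y z * (ln (phi y + phi z) - ln (phi y))).
  apply: eq_bigr => y /andP[yX yx]; rewrite (bigD1 x) ?xX 1?eq_sym ?yx //=.
  by congr (_ + _); apply: eq_bigl => z; rewrite andbA.
rewrite big_split addrA -big_split /=; congr (_ + _); apply: eq_bigr => y _.
rewrite /turnover (addrC (phi y)); ring.
Qed.

Lemma likelihood_ratio_path (H : R) x s :
  path (fun a b => (a != b) && (0 < w a b)) x s ->
  last x s \in X -> x \in X /\ exists2 C, 0 < C &
    forall phi, {in X, forall z, 0 < phi z} -> h phi <= H ->
      phi (last x s) <= C * phi x.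
Proof.
elim: s x => [|z s IHs] x /=.
  by move=> _ xX; split=> //; exists 1 => // phi _ _; rewrite mul1r.
case/andP => /andP[xz wxz] path_s last_s.
have [zX [C C0 IH]] := IHs z path_s last_s.
have xX : x \in X by apply: contraTT wxz => xX; rewrite (top_cut w_ge0 topX zX xX) ltxx.
split=> //; exists (C * expR (H / w x z)); first by rewrite mulr_gt0 ?expR_gt0.
move=> phi phi0 hH; apply: (le_trans (IH _ phi0 hH)).
rewrite -mulrA ler_pM2l //; have [px pz] := (phi0 _ xX, phi0 _ zX).
have zx : z != x by rewrite eq_sym.
have := le_trans (likelihood_ge_term phi0 xX zX zx) hH.
rewrite mulrC -ler_pdivlMr // -ln_div ?posrE ?addr_gt0 // => ln_le.
have : (phi x + phi z) / phi x <= expR (H / w x z).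
  rewrite -(lnK (x := (phi x + phi z) / phi x)) ?ler_expR //.
  by rewrite posrE divr_gt0 ?addr_gt0.
by rewrite ler_pdivrMr //; lra.
Qed.

Lemma likelihood_ratio (H : R) : exists2 C, 1 <= C &
  forall phi, {in X, forall z, 0 < phi z} -> h phi <= H ->
    forall x y, x \in X -> y \in X -> phi y <= C * phi x.
Proof.
have /choice[C C_P] : forall p : A * A, exists c : R, 0 <= c /\
    (p.1 \in X -> p.2 \in X -> forall phi, {in X, forall z, 0 < phi z} ->
       h phi <= H -> phi p.2 <= c * phi p.1).
  move=> [x y] /=; have [xX|xX] := boolP (x \in X); last by exists 0.
  have [yX|yX] := boolP (y \in X); last by exists 0.
  have /connectP[s path_s last_s] := top_reach topX y xX.
  have [|_ [c c0 c_P]] := likelihood_ratio_path H path_s; first by rewrite -last_s.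
  by exists c; split; [exact: ltW|move=> _ _; rewrite last_s].
exists (1 + \sum_p C p) => [|phi phi0 hH x y xX yX].
  by rewrite lerDl sumr_ge0 // => p _; have [] := C_P p.
have [_ /(_ xX yX phi phi0 hH)/le_trans] := C_P (x, y); apply.
rewrite ler_pM2r ?phi0 // (bigD1 (x, y)) //=.
have : 0 <= \sum_(p | p != (x, y)) C p.
  by apply: sumr_ge0 => p _; have [] := C_P p.
lra.
Qed.

(** Coercivity modulo scaling: a family at least as good as the constant 1, divided by its largest
    coordinate on X, lies between 1 / C and 1 on X, so the minimum over the compact box is
    global. *)
Lemma likelihood_minimizer : exists2 phi, {in X, forall z, 0 < phi z} &
  forall psi, {in X, forall z, 0 < psi z} -> h phi <= h psi.
Proof.
have one0 : {in X, forall z : A, 0 < (1 : R)} by move=> z _; exact: ltr01.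
have [C C1 ratio] := likelihood_ratio (h (fun=> 1)).
have C0 : 0 < C := lt_le_trans ltr01 C1.
pose box := [set phi : A -> R | forall x, C^-1 <= phi x <= 1].
have box_pos phi : box phi -> {in X, forall z, 0 < phi z}.
  by move=> bphi z _; have /andP[+ _] := bphi z; apply: lt_le_trans; rewrite invr_gt0.
have [||G GU Gbox|phi bphi min_phi] := @exists_minimizer R _ box h 0.
- by exists (fun=> 1) => x; rewrite lexx invf_le1 // C1.
- by move=> phi /box_pos; exact: likelihood_ge0.
- have /choice[psi cvg_psi] : forall x, exists l : R, phi x @[phi --> G] --> l.
    move=> x; apply: (ultra_bounded_cvg (a := C^-1) (b := 1)).
    by apply: filterS Gbox => phi; exact.
  have box_psi : box psi.
    move=> x; apply/andP; split.
      apply: (cvg_le (cvg_cst (C^-1)) (cvg_psi x)).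
      by apply: filterS Gbox => phi /(_ x)/andP[].
    apply: (cvg_le (cvg_psi x) (cvg_cst (1 : R))).
    by apply: filterS Gbox => phi /(_ x)/andP[].
  exists psi => //; apply: cvg_likelihood => //; exact: box_pos.
exists phi; first exact: box_pos.
move=> psi psi0; have [hpsi|] := leP (h psi) (h (fun=> 1)); last first.
  move=> /ltW; apply: le_trans; apply: min_phi => x.
  by rewrite lexx invf_le1 // C1.
have [x0 x0X] := top_nonempty topX.
have [m mX max_m] := @arg_maxP _ _ _ x0 (mem X) psi x0X.
have {}mX : m \in X by [].
have pm := psi0 _ mX.
(* The box constrains all coordinates, while [h] sees only those in X; the value 1 elsewhere keeps
   the rescaled family in the box. *)
pose chi x := if x \in X then (psi m)^-1 * psi x else 1.
have -> : h psi = h chi.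
  rewrite -(@likelihood_scale psi (psi m)^-1) ?invr_gt0 //.
  by apply: eq_likelihood => x xX; rewrite /chi xX.
apply: min_phi => x; rewrite /chi; case: ifP => xX; last first.
  by rewrite lexx invf_le1 // C1.
rewrite mulrC ler_pdivlMr // ler_pdivrMr // mul1r.
rewrite mulrC ler_pdivrMr // (mulrC _ C) ratio //=.
exact: max_m.
Qed.

Lemma le_of_scaled (u v : R) : 0 <= v ->
  (forall e, 0 < e -> u <= v * (1 + e)) -> u <= v.
Proof.
move=> v0 uv; rewrite leNgt; apply/negP => vu.
(* The denominator exceeds v and stays positive at v = 0, so that v * (1 + e) remains below u. *)
have e0 : 0 < (u - v) / (2 * v + 1) by rewrite divr_gt0 //; lra.
have := uv _ e0; rewrite leNgt => /negP; apply.
have : v * ((u - v) / (2 * v + 1)) < u - v.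
  by rewrite mulrCA gtr_pMr ?subr_gt0 // ltr_pdivrMr; lra.
lra.
Qed.

(* Minimality tested on the variations s = a (1 + e) and s = a / (1 + e) of one
   coordinate a gives the two inequalities; only ln z <= z - 1 is needed. *)
Lemma likelihood_stationary phi : {in X, forall z, 0 < phi z} ->
  (forall psi, {in X, forall z, 0 < psi z} -> h phi <= h psi) ->
  forall x, x \in X ->
    \sum_(y in X | y != x) turnover w x y * (phi x / (phi x + phi y)) =
    \sum_(y in X | y != x) w x y.
Proof.
move=> phi0 min_phi x xX; have a0 := phi0 _ xX; set a := phi x in a0 *.
pose P := \sum_(y in X | y != x) turnover w x y / (a + phi y).
pose W := \sum_(y in X | y != x) w x y.
(* An upper bound for the change of [h] when the coordinate a becomes s. It factors as (s - a) * (P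
   - W / s), so taking s on either side of a and letting it tend to a forces P * a = W. *)
have var s : 0 < s -> 0 <= (s - a) * P + W * ((a - s) / s).
  move=> s0; pose psi y := if y == x then s else phi y.
  have psi0 : {in X, forall z, 0 < psi z}.
    by move=> z zX; rewrite /psi; case: ifP => // _; exact: phi0.
  have := min_phi _ psi0; rewrite !(likelihood_split _ xX).
  have -> : \sum_(y in X | y != x) \sum_(z | [&& z \in X, z != y & z != x])
      w y z * (ln (psi y + psi z) - ln (psi y)) =
    \sum_(y in X | y != x) \sum_(z | [&& z \in X, z != y & z != x])
      w y z * (ln (phi y + phi z) - ln (phi y)).
    apply: eq_bigr => y /andP[_ yx]; apply: eq_bigr => z /and3P[_ _ zx].
    by rewrite /psi (negbTE yx) (negbTE zx).
  rewrite lerD2r -subr_ge0 -sumrB => /le_trans; apply.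
  rewrite /P /W mulr_sumr mulr_suml -big_split /=; apply: ler_sum => y /andP[yX yx].
  rewrite /psi eqxx (negbTE yx) -/a; have py := phi0 _ yX.
  have t0 : 0 <= turnover w x y by apply: addr_ge0; apply: w_ge0; rewrite // eq_sym.
  have wxy0 : 0 <= w x y by apply: w_ge0; rewrite eq_sym.
  have l1 : ln (s + phi y) - ln (a + phi y) <= (s - a) / (a + phi y).
    have -> : s - a = (s + phi y) - (a + phi y) by ring.
    by apply: ln_sub_le; rewrite addr_gt0.
  have l2 := ln_sub_le a0 s0.
  have := ler_wpM2l t0 l1; have := ler_wpM2l wxy0 l2.
  have -> : (s - a) * (turnover w x y / (a + phi y)) =
            turnover w x y * ((s - a) / (a + phi y)) by ring.
  lra.
have P0 : 0 <= P.
  apply: sumr_ge0 => y /andP[yX yx]; apply: divr_ge0.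
    by apply: addr_ge0; apply: w_ge0; rewrite // eq_sym.
  by rewrite ltW // addr_gt0 // phi0.
have W0 : 0 <= W by apply: sumr_ge0 => y /andP[_ yx]; apply: w_ge0; rewrite eq_sym.
suff PW : P * a = W.
  rewrite -/W -PW /P mulr_suml; apply: eq_bigr => y _; ring.
apply/le_anti/andP; split; apply: le_of_scaled => //; last first.
- move=> e e0; have s0 : 0 < a * (1 + e) by rewrite mulr_gt0 //; lra.
  have := var _ s0.
  have -> : a * (1 + e) - a = a * e by ring.
  have -> : (a - a * (1 + e)) / (a * (1 + e)) = - (e / (1 + e)).
    by field; rewrite !gt_eqF //; lra.
  rewrite mulrN subr_ge0 mulrA ler_pdivrMr; last lra.
  have -> : a * e * P * (1 + e) = (P * a * (1 + e)) * e by ring.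
  by rewrite ler_pM2r.
- exact: mulr_ge0 (ltW a0).
move=> e e0; have s0 : 0 < a / (1 + e) by rewrite divr_gt0 //; lra.
have := var _ s0.
have -> : a / (1 + e) - a = - (a * (e / (1 + e))) by field; rewrite gt_eqF //; lra.
have -> : (a - a / (1 + e)) / (a / (1 + e)) = e.
  by field; rewrite !gt_eqF //; lra.
rewrite mulNr addrC subr_ge0.
have -> : a * (e / (1 + e)) * P = P * a * e / (1 + e) by ring.
rewrite ler_pdivrMr; last lra.
have -> : W * e * (1 + e) = W * (1 + e) * e by ring.
by rewrite ler_pM2r.
Qed.

(** The stationarity equations are homogeneous of degree 0, so the minimizer can be rescaled to
    total f. *)
Lemma fraction_rates_exists f : 0 < f -> exists phi, is_fraction_rates w f X phi.
Proof.
move=> f0; have [phi phi0 min_phi] := likelihood_minimizer.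
have stat := likelihood_stationary phi0 min_phi.
have [x0 x0X] := top_nonempty topX.
pose S := \sum_(x in X) phi x.
have S0 : 0 < S.
  rewrite /S (bigD1 x0) //=; apply: ltr_wpDr; last exact: phi0.
  by apply: sumr_ge0 => x /andP[xX _]; exact/ltW/phi0.
exists (fun x => if x \in X then f / S * phi x else 0); split.
- by move=> x /negbTE->.
- by move=> x xX; rewrite xX mulr_gt0 ?divr_gt0 ?phi0.
- transitivity (\sum_(x in X) f / S * phi x).
    by apply: eq_bigr => x ->.
  by rewrite -mulr_sumr -/S divfK // gt_eqF.
move=> x xX; rewrite xX -(stat x xX); apply: eq_bigr => y /andP[yX _]; rewrite yX.
have [px py] := (phi0 _ xX, phi0 _ yX).
by congr (_ * _); field; rewrite !gt_eqF ?addr_gt0 ?mulr_gt0.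
Qed.

End Existence.

(** * Limits of fraction-like rates *)

Lemma antisymmetric_sum (R : realType) (A : finType) (Z : {set A}) (d : A -> A -> R) :
  (forall x y, x \in Z -> y \in Z -> x != y -> d y x = - d x y) ->
  \sum_(x in Z) \sum_(y in Z | y != x) d x y = 0.
Proof.
move=> anti; set D := LHS.
suff : D = - D by move=> ?; lra.
rewrite {1}/D (exchange_big_dep (mem Z)) /=; last by move=> x y _ /andP[].
rewrite -sumrN; apply: eq_bigr => x xZ; rewrite -sumrN.
under eq_bigl => y do rewrite andbA andbAC.
transitivity (\sum_(y in Z | y != x) d y x).
  by apply: eq_bigl => y; rewrite xZ andbT (eq_sym x).
by apply: eq_bigr => y /andP[yZ yx]; rewrite anti // eq_sym.
Qed.

Section FractionLimit.
Context {R : realType} {A : finType}.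
Implicit Types (w : A -> A -> R) (phi psi : A -> R) (X Y Z : {set A}) (x y : A).

(** Score of x against y predicted by Zermelo's model minus the actual one. The rate equation at x
    says that these add up to 0 over the opponents of x. *)
Definition excess w psi x y : R :=
  turnover w x y * (psi x / (psi x + psi y)) - w x y.

Lemma excess_antisym w psi x y : 0 < psi x -> 0 < psi y ->
  excess w psi y x = - excess w psi x y.
Proof.
move=> px py; rewrite /excess /turnover; field.
by rewrite !gt_eqF ?addr_gt0.
Qed.

(** When the rate equations are summed over Z, pairs inside Z cancel by antisymmetry and only the
    boundary terms remain. *)
Lemma excess_cut w psi Y Z : Z \subset Y -> {in Z, forall x, 0 < psi x} ->
  {in Z, forall x, \sum_(y in Y | y != x) excess w psi x y = 0} ->
  \sum_(x in Z) \sum_(y in Y | y \notin Z) excess w psi x y = 0.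
Proof.
move=> /fintype.subsetP ZY pos eq0.
have := antisymmetric_sum (Z := Z) (d := excess w psi).
move=> /(_ (fun x y xZ yZ _ => excess_antisym w (pos x xZ) (pos y yZ))) inner.
suff : \sum_(x in Z) \sum_(y in Y | y != x) excess w psi x y =
    \sum_(x in Z) \sum_(y in Z | y != x) excess w psi x y +
    \sum_(x in Z) \sum_(y in Y | y \notin Z) excess w psi x y.
  by rewrite inner add0r => <-; rewrite big1.
rewrite -big_split /=; apply: eq_bigr => x xZ.
rewrite [LHS](bigID (mem Z)) /=; congr (_ + _); apply: eq_bigl => y.
  by case yZ: (y \in Z) => //=; rewrite ?(ZY _ yZ) ?andbT ?andbF.
case yZ: (y \in Z); rewrite ?andbF //= !andbT.
by case: (eqVneq y x) => [yx|_]; rewrite ?andbT //; rewrite yx xZ in yZ.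
Qed.

(* A limit psi of fraction-like rates satisfies the rate equations where it is
   positive. Summing them over the support S of psi, and then over X, shows that
   no positive score enters S from outside, nor S from X; hence S = X. *)
Lemma limit_fraction_rates w f X Y psi :
  nonneg_scores w -> top_dominant_component w X -> 0 < f ->
  (forall x, 0 <= psi x) -> (forall x, x \notin Y -> psi x = 0) ->
  \sum_(x in Y) psi x = f ->
  (forall x y, x \in Y -> y \notin Y -> w y x = 0) ->
  (forall x, x \in Y -> 0 < psi x ->
     \sum_(y in Y | y != x) turnover w x y * (psi x / (psi x + psi y)) =
     \sum_(y in Y | y != x) w x y) ->
  is_fraction_rates w f X psi.
Proof.
move=> w0 topX f0 psi0 psiY psi_sum Ycut psi_eq.
pose S := [set x | 0 < psi x]%SET.
have notinS y : y \notin S -> psi y = 0.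
  by rewrite inE -leNgt => py; apply/le_anti; rewrite py psi0.
have SY : S \subset Y.
  apply/fintype.subsetP => x; rewrite inE; apply: contraTT => /psiY->.
  by rewrite ltxx.
have inSY := fintype.subsetP SY.
have posS : {in S, forall x, 0 < psi x} by move=> x; rewrite inE.
have eqS : {in S, forall x, \sum_(y in Y | y != x) excess w psi x y = 0}.
  by move=> x xS; rewrite sumrB psi_eq ?subrr ?inSY ?posS.
have excessS x y : x \in S -> y \notin S -> excess w psi x y = w y x.
  move=> xS yS; rewrite /excess (notinS _ yS) addr0 divff ?gt_eqF ?posS //.
  by rewrite mulr1 /turnover addrAC subrr add0r.
have neqS (Z : {set A}) x y : x \in Z -> y \notin Z -> y != x.
  by move=> xS; apply: contraNneq => ->.
have Scut x y : x \in S -> y \notin S -> w y x = 0.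
  move=> xS yS; have [yY|yY] := boolP (y \in Y); last exact: Ycut (inSY _ xS) yY.
  have pos z t : z \in S -> (t \in Y) && (t \notin S) -> 0 <= excess w psi z t.
    by move=> zS /andP[_ tS]; rewrite excessS // w0 // (neqS S).
  have := excess_cut SY posS eqS.
  move=> /psumr_eq0P; move=> /(_ (fun z zS => sumr_ge0 _ (fun t => pos z t zS))).
  move=> /(_ x xS) /psumr_eq0P; move=> /(_ (fun t => pos x t xS)) /(_ y).
  by rewrite yY yS excessS // => /(_ isT).
have [s sS] : exists s, s \in S.
  apply/set0Pn; apply: contraTneq f0 => S0; rewrite -psi_sum big1 ?ltxx // => x _.
  by apply: notinS; rewrite S0 inE.
have XS : X \subset S := top_sub topX sS Scut.
have inXS := fintype.subsetP XS.
(* No score enters X, so every boundary excess of X is nonpositive and, their sum being 0, vanishes.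
   When the outer element lies in S the predicted fraction is strictly below 1, which forces the
   score itself to be 0. *)
have Xcut x y : x \in X -> y \in S -> y \notin X -> w x y = 0.
  move=> xX yS yX.
  have excessX z t : z \in X -> t \notin X ->
      excess w psi z t = w z t * (psi z / (psi z + psi t) - 1).
    move=> zX tX; rewrite /excess /turnover (top_cut w0 topX zX tX) addr0; ring.
  have frac z t : z \in X -> psi z / (psi z + psi t) <= 1.
    move=> zX; have pz := posS _ (inXS _ zX); have pt := psi0 t.
    by rewrite ler_pdivrMr ?mul1r ?lerDl // ltr_wpDr.
  have neg z t : z \in X -> (t \in Y) && (t \notin X) -> 0 <= - excess w psi z t.
    move=> zX /andP[_ tX]; rewrite excessX // -mulrN; apply: mulr_ge0.
      by apply: w0; rewrite eq_sym (neqS X).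
    by rewrite opprB subr_ge0 frac.
  have : \sum_(z in X) \sum_(t in Y | t \notin X) - excess w psi z t = 0.
    under eq_bigr do rewrite sumrN.
    rewrite sumrN (excess_cut (fintype.subset_trans XS SY)) ?oppr0 //.
      by move=> z /inXS/posS.
    by move=> z /inXS/eqS.
  move=> /psumr_eq0P; move=> /(_ (fun z zX => sumr_ge0 _ (fun t => neg z t zX))).
  move=> /(_ x xX) /psumr_eq0P; move=> /(_ (fun t => neg x t xX)) /(_ y).
  rewrite (inSY _ yS) yX excessX // => /(_ isT)/eqP.
  rewrite oppr_eq0 mulf_eq0 => /orP[/eqP//|]; rewrite subr_eq0 => /eqP frac1.
  have px := posS _ (inXS _ xX); have py := posS _ yS.
  suff : psi x / (psi x + psi y) < 1 by rewrite frac1 ltxx.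
  by rewrite ltr_pdivrMr ?addr_gt0 // mul1r ltrDl.
have SX : S \subset X.
  apply/fintype.subsetP => y yS; apply: contrapT => /negP yX.
  have [x xX] := top_nonempty topX.
  (* A positive edge leaving this set would enter S minus X, either from X, against [Xcut], or from
     outside S, against [Scut]. *)
  have [||a [b [aZ bZ _ wab]]] := top_cut_crossing topX (Z := X :|: ~: S) (y := y) xX.
  - by rewrite finset.in_setU xX.
  - by rewrite finset.in_setU finset.in_setC negb_or negbK yX.
  move: bZ; rewrite finset.in_setU finset.in_setC negb_or negbK => /andP[bX bS].
  move: aZ; rewrite finset.in_setU finset.in_setC => /orP[aX|aS].
    by rewrite (Xcut a b) ?ltxx in wab.
  by rewrite (Scut b a) ?ltxx in wab.
have eqSX : S = X by apply/eqP; rewrite finset.eqEsubset SX XS.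
have outX x : x \notin X -> psi x = 0 by rewrite -eqSX; exact: notinS.
have inXY x : x \in X -> x \in Y by move=> /inXS/inSY.
split=> //.
- by move=> x /inXS/posS.
- rewrite -psi_sum [RHS](bigID (mem X)) /= [X in _ + X]big1 ?addr0.
    by apply: eq_bigl => x; case xX: (x \in X); rewrite ?andbF // inXY.
  by move=> x /andP[_ /outX].
move=> x xX; apply/eqP; rewrite -subr_eq0 -sumrB; apply/eqP.
have := eqS _ (inXS _ xX); rewrite (bigID (mem X)) /= [X in _ + X]big1 ?addr0.
  move=> eq0; rewrite -[RHS]eq0; apply: eq_bigl => y.
  by case yX: (y \in X); rewrite ?andbF //= ?andbT inXY.
move=> y /andP[_ yX]; have yS : y \notin S by rewrite eqSX.
by rewrite (excessS _ _ (inXS _ xX) yS) (Scut _ _ (inXS _ xX) yS).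
Qed.

Lemma cvg_fraction_rates (T : Type) (G : set_system T) {GU : UltraFilter G}
    (w : T -> A -> A -> R) w0 (f : T -> R) (f0 : R) X Y (phi : T -> A -> R) phi0 x :
  (forall x y, x != y -> w t x y @[t --> G] --> w0 x y) -> f @ G --> f0 ->
  (\forall t \near G, nonneg_scores (w t)) -> nonneg_scores w0 -> 0 < f0 ->
  (\forall t \near G, top_dominant_component (w t) Y) ->
  (\forall t \near G, is_fraction_rates (w t) (f t) Y (phi t)) ->
  top_dominant_component w0 X -> is_fraction_rates w0 f0 X phi0 ->
  phi t x @[t --> G] --> phi0 x.
Proof.
move=> cvgw cvgf wt0 w00 f00 topY ratesY topX rates0.
have phi_bounds : \forall t \near G, forall x, 0 <= phi t x <= f0 + 1.
  have f1 : \forall t \near G, f t < f0 + 1 by apply: (cvgr_lt _ cvgf); rewrite ltrDl.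
  apply: filterS2 f1 ratesY => t ft [phi_out phi_pos phi_sum _] y.
  have phi_ge0 z : 0 <= phi t z.
    by have [/phi_pos/ltW//|/phi_out->] := boolP (z \in Y).
  rewrite phi_ge0 /=; have [yY|/phi_out->] := boolP (y \in Y); last by lra.
  apply: le_trans (ltW ft); rewrite -phi_sum (bigD1 y) //= lerDl.
  by apply: sumr_ge0.
have /choice[psi cvg_psi] : forall y, exists l : R, phi t y @[t --> G] --> l.
  move=> y; apply: (ultra_bounded_cvg (a := 0) (b := f0 + 1)).
  by apply: filterS phi_bounds => t; exact.
suff rates_psi : is_fraction_rates w0 f0 X psi.
  by rewrite (fraction_rates_unique w00 topX rates0 rates_psi); exact: cvg_psi.
have cst_lim (g : T -> R) a b : g @ G --> a -> (\forall t \near G, g t = b) -> a = b.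
  move=> ga gb; apply: (cvg_unique _ ga) => //.
  by apply: (cvg_trans (near_eq_cvg _)) (cvg_cst b); apply: filterS gb => t ->.
apply: (@limit_fraction_rates w0 f0 X Y psi) => //.
- move=> y; apply: (cvg_le (cvg_cst (0 : R)) (cvg_psi y)).
  by apply: filterS phi_bounds => t /(_ y)/andP[].
- move=> y yY; apply: (cst_lim _ _ _ (cvg_psi y)).
  by apply: filterS ratesY => t [+ _ _ _]; exact.
- apply/eqP; rewrite -subr_eq0; apply/eqP.
  apply: (cst_lim (fun t => \sum_(y in Y) phi t y - f t)).
    by apply: cvgB => //; exact: cvg_sumr.
  by apply: filterS ratesY => t [_ _ -> _]; rewrite subrr.
- move=> y z yY zY; have zy : z != y by apply: contraNneq zY => ->.
  apply: (cst_lim _ _ _ (cvgw _ _ zy)).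
  by apply: filterS2 wt0 topY => t wt topt; exact: top_cut yY zY.
move=> y yY py; apply/eqP; rewrite -subr_eq0; apply/eqP.
apply: (cst_lim (fun t => \sum_(z in Y | z != y)
     turnover (w t) y z * (phi t y / (phi t y + phi t z)) -
     \sum_(z in Y | z != y) w t y z)); last first.
  by apply: filterS ratesY => t [_ _ _ ->]; rewrite ?subrr.
apply: cvgB; apply: cvg_sumr => z /andP[zY zy]; last by apply: cvgw; rewrite eq_sym.
apply: cvgM; first by apply: cvgD; apply: cvgw; rewrite // eq_sym.
apply: cvgM; first exact: cvg_psi.
(* The positive limit at y keeps the denominator away from 0 even if the limit at z is 0. *)
apply: cvgV; last by apply: cvgD; exact: cvg_psi.
rewrite gt_eqF // ltr_wpDr //.
apply: (cvg_le (cvg_cst (0 : R)) (cvg_psi z)).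
by apply: filterS phi_bounds => t /(_ z)/andP[].
Qed.

End FractionLimit.

(** * Continuity of the rates *)

Section Rates.
Context {R : realType} {A : finType}.
Implicit Types (v : A -> A -> R) (x y : A).

Lemma zero_offdiagPn v : reflect (exists x y, x != y /\ v x y != 0) (~~ zero_offdiag v).
Proof.
rewrite negb_forall; apply: (iffP existsP) => [[x]|[x [y [xy vxy]]]].
  by rewrite negb_forall => /existsP[y]; rewrite negb_imply => /andP[]; exists x, y.
by exists x; rewrite negb_forall; apply/existsP; exists y; rewrite xy.
Qed.

(** The component chosen inside [fraction_rate], named so that it can be made constant along an
    ultrafilter. *)
Definition top_component v : {set A} :=
  odflt finset.set0 [pick X | top_dominant_component (projected_scores v) X].

Lemma fraction_rateP v (f : R) : unit_scores v -> ~~ zero_offdiag v -> 0 < f ->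
  top_dominant_component (projected_scores v) (top_component v) /\
  is_fraction_rates (projected_scores v) f (top_component v) (fraction_rate v f).
Proof.
move=> v01 v_neq0 f0.
have topX : top_dominant_component (projected_scores v) (top_component v).
  rewrite /top_component; case: pickP => [//|none].
  have [x1 x1_source] := projected_scores_source v01 v_neq0.
  by have [X] := top_dominant_exists x1_source; rewrite none.
split=> //; rewrite /fraction_rate (negbTE v_neq0).
apply: (getPex (P := [set phi | is_fraction_rates (projected_scores v) f _ phi])).
apply: fraction_rates_exists => // x y; exact: projected_scores_ge0.
Qed.

Lemma fraction_rate_bounds v (f : R) x : unit_scores v -> 0 <= f ->
  (~~ zero_offdiag v -> 0 < f) -> 0 <= fraction_rate v f x <= f.
Proof.
move=> v01 f0 vf; have [v0|v0] := boolP (zero_offdiag v).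
  by rewrite /fraction_rate v0 lexx.
have [_ [phi_out phi_pos phi_sum _]] := fraction_rateP v01 v0 (vf v0).
have [xX|/phi_out->] := boolP (x \in top_component v); last by rewrite lexx.
rewrite ltW ?phi_pos //= -[leRHS]phi_sum (bigD1 x) //= lerDl.
by apply: sumr_ge0 => y /andP[yX _]; exact/ltW/phi_pos.
Qed.

Lemma cvg_rank_rate (T : Type) (F : set_system T) {FF : Filter F}
    (v : T -> A -> A -> R) v0 x :
  (\forall t \near F, unit_scores (v t)) -> unit_scores v0 ->
  (forall a b, v t a b @[t --> F] --> v0 a b) ->
  rank_rate (v t) x @[t --> F] --> rank_rate v0 x.
Proof.
move=> v01 v001 cvgv; apply: cvgB; first exact: cvg_cst.
by apply: cvg_sumr => y yx; apply: cvg_projected_scores => //; rewrite eq_sym.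
Qed.

Lemma cvg_fraction_rate (T : Type) (F : set_system T) {FF : Filter F}
    (v : T -> A -> A -> R) v0 (f : T -> R) (f0 : R) x :
  (\forall t \near F, unit_scores (v t)) -> unit_scores v0 ->
  (forall a b, v t a b @[t --> F] --> v0 a b) ->
  (\forall t \near F, 0 <= f t /\ (~~ zero_offdiag (v t) -> 0 < f t)) ->
  f @ F --> f0 -> (zero_offdiag v0 -> f0 = 0) -> (~~ zero_offdiag v0 -> 0 < f0) ->
  fraction_rate (v t) (f t) x @[t --> F] --> fraction_rate v0 f0 x.
Proof.
move=> v01F v001 cvgvF ftF cvgfF f0_eq0 f0_gt0.
(* At [v0 = 0] no limit equation is needed: the nearby rates are squeezed between 0 and f, which
   tends to 0. *)
have [v00|v00] := boolP (zero_offdiag v0).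
  have -> : fraction_rate v0 f0 x = 0 by rewrite /fraction_rate v00.
  rewrite f0_eq0 // in cvgfF.
  apply/cvgrPdist_lt => e e0; move/cvgrPdist_lt : cvgfF => /(_ e e0) cvgfF.
  apply: filterS3 v01F ftF cvgfF => t vt01 [ft0 vft].
  have /andP[phi0 phif] := fraction_rate_bounds x vt01 ft0 vft.
  by rewrite !sub0r !normrN !ger0_norm //; exact: le_lt_trans.
have {}f0_gt0 := f0_gt0 v00.
apply: cvg_ultra => G GU FG.
have v01 : \forall t \near G, unit_scores (v t) by exact: FG.
have ft : \forall t \near G, 0 <= f t /\ (~~ zero_offdiag (v t) -> 0 < f t).
  exact: FG.
have cvgf : f @ G --> f0 := cvg_trans (cvg_app _ FG) cvgfF.
have cvgv a b : v t a b @[t --> G] --> v0 a b.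
  exact: cvg_trans (cvg_app _ FG) (cvgvF a b).
have v_neq0 : \forall t \near G, ~~ zero_offdiag (v t).
  have /zero_offdiagPn[a [b [ab vab]]] := v00.
  have v0ab : 0 < v0 a b.
    by rewrite lt_neqAle eq_sym vab; have /andP[] := v001 _ _ ab.
  have : \forall t \near G, 0 < v t a b by exact: (cvgr_gt _ (cvgv a b)).
  apply: filterS => t vtab; apply/zero_offdiagPn; exists a, b; split=> //.
  by rewrite gt_eqF.
have [Y Y_t] := ultra_fin (G := G) (fun t => top_component (v t)).
have spec : \forall t \near G,
    top_dominant_component (projected_scores (v t)) Y /\
    is_fraction_rates (projected_scores (v t)) (f t) Y (fraction_rate (v t) (f t)).
  have ft0 : \forall t \near G, 0 < f t.
    by apply: filterS2 ft v_neq0 => t [_]; exact.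
  have vt : \forall t \near G, unit_scores (v t) /\ ~~ zero_offdiag (v t).
    exact: filterI.
  by apply: filterS3 vt ft0 Y_t => t [vt01 vt0] ft0 <-; exact: fraction_rateP.
have [top0 rates0] := fraction_rateP v001 v00 f0_gt0.
apply: (cvg_fraction_rates (w := fun t => projected_scores (v t)) (Y := Y)
  (phi := fun t => fraction_rate (v t) (f t)) (x := x)
  _ cvgf _ _ f0_gt0 _ _ top0 rates0).
- by move=> a b ab; exact: cvg_projected_scores.
- by apply: filterS v01 => t vt01 a b; exact: projected_scores_ge0.
- by move=> a b; exact: projected_scores_ge0.
- by apply: filterS spec => t [].
- by apply: filterS spec => t [].
Qed.

End Rates.

(** * Collective matrices as functions of the relative frequencies *)

Section Collective.
Context {R : realType} {A K : finType}.
Variables (vk : K -> A -> A -> R).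
Hypothesis hvk : forall k, llull (vk k).
Implicit Types alpha : {ptws K -> R}.

Lemma collective_unit alpha : relative_frequencies alpha ->
  unit_scores (collective_matrix vk alpha).
Proof.
move=> [alpha0 alpha1] x y xy; rewrite /collective_matrix.
have vk01 k := llull_unit_scores (hvk k) xy.
apply/andP; split.
  by apply: sumr_ge0 => k _; apply: mulr_ge0 => //; have /andP[] := vk01 k.
rewrite -[leRHS]alpha1; apply: ler_sum => k _; apply: ler_piMr => //.
by have /andP[] := vk01 k.
Qed.

Lemma nonempty_fraction_ge0 alpha : relative_frequencies alpha ->
  0 <= nonempty_fraction vk alpha.
Proof. by move=> [alpha0 _]; exact: sumr_ge0. Qed.

(** Entries of the votes are nonnegative, so non-empty votes cannot cancel. Thus f vanishes exactly
    where the fraction-like rates are set to 0. *)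
Lemma nonempty_fraction_eq0 alpha : relative_frequencies alpha ->
  (nonempty_fraction vk alpha == 0) = zero_offdiag (collective_matrix vk alpha).
Proof.
move=> [alpha0 alpha1].
rewrite /nonempty_fraction psumr_eq0 => [|k _]; last exact: alpha0.
apply/allP/idP => [a0|].
  apply/forallP => x; apply/forallP => y; apply/implyP => xy.
  rewrite /collective_matrix big1 // => k _.
  have := a0 k (mem_index_enum k); have [zk _|_ /eqP->] := boolP (zero_offdiag (vk k)).
    by move/forallP/(_ x)/forallP/(_ y) : zk; rewrite xy => /eqP->; rewrite mulr0.
  by rewrite mul0r.
move=> /forallP z k _; apply/implyP => /zero_offdiagPn[x [y [xy vxy]]].
move: (z x) => /forallP/(_ y); rewrite xy /collective_matrix /= psumr_eq0.
  move=> /allP/(_ k (mem_index_enum k)); rewrite /= mulf_eq0.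
  by rewrite (negbTE vxy) orbF.
move=> j _; apply: mulr_ge0 => //.
by have /andP[] := llull_unit_scores (hvk j) xy.
Qed.

Lemma cvg_frequency alpha k : (beta k : R) @[beta --> nbhs alpha] --> (alpha k : R).
Proof. exact: (@proj_continuous K (fun=> R) k alpha). Qed.

End Collective.

Theorem corollary13p2 (R : realType) (A K : finType) (hA : (2 <= #|A|)%N)
    (vk : K -> A -> A -> R) (hvk : forall k, llull (vk k)) (x : A) :
  {within @relative_frequencies R K, continuous (fun alpha : {ptws K -> R} =>
     rank_rate (collective_matrix vk alpha) x)} /\
  {within @relative_frequencies R K, continuous (fun alpha : {ptws K -> R} =>
     fraction_rate (collective_matrix vk alpha)
                   (nonempty_fraction vk alpha) x)}.
Proof.
have near_freq (alpha : {ptws K -> R}) :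
    \forall beta \near within (@relative_frequencies R K) (nbhs alpha),
      @relative_frequencies R K beta by exact: withinT.
have cvg_freq (alpha : {ptws K -> R}) k :
    (beta k : R) @[beta --> within (@relative_frequencies R K) (nbhs alpha)] -->
    (alpha k : R).
  apply: cvg_within_filter; last exact: cvg_frequency.
  exact: (@nbhs_filter {ptws K -> R}).
have cvg_mx (alpha : {ptws K -> R}) a b :
    collective_matrix vk beta a b
      @[beta --> within (@relative_frequencies R K) (nbhs alpha)] -->
    collective_matrix vk alpha a b.
  by apply: cvg_sumr => k _; apply: cvgM; [exact: cvg_freq | exact: cvg_cst].
have near_unit (alpha : {ptws K -> R}) :
    \forall beta \near within (@relative_frequencies R K) (nbhs alpha),
      unit_scores (collective_matrix vk beta).
  by apply: filterS (near_freq alpha) => beta; exact: collective_unit.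
split; apply/subspace_continuousP => alpha alphaD.
  by apply: cvg_rank_rate => //; exact: collective_unit.
have pos (beta : {ptws K -> R}) : relative_frequencies beta ->
    ~~ zero_offdiag (collective_matrix vk beta) -> 0 < nonempty_fraction vk beta.
  move=> betaD; rewrite -(nonempty_fraction_eq0 hvk) // => nz.
  by rewrite lt_neqAle eq_sym nz nonempty_fraction_ge0.
apply: cvg_fraction_rate => //.
- exact: collective_unit.
- apply: filterS (near_freq alpha) => beta betaD.
  by split; [exact: nonempty_fraction_ge0 | exact: pos].
- by apply: cvg_sumr => k _; exact: cvg_freq.
- by rewrite -(nonempty_fraction_eq0 hvk) // => /eqP.
- exact: pos.
Qed.
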